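(* Assume the APSP-hardness conjecture, i.e., that the all-pairs shortest path problem cannot be solved in $O(n^{3-\epsilon})$ time for any constant $\epsilon>0$. Then the 2FRP problem in undirected weighted graphs cannot be solved in $O(n^{3-\epsilon})$ time for any constant $\epsilon>0$.
   Context: Here $n$ is the number of vertices. The 2-fault replacement path (2FRP) problem: given an undirected weighted graph $G$ and vertices $s,t$, compute for every set $F$ of at most two edges the length of the shortest $s$-$t$ path in $G-F$ (equivalently, for every edge $d_1$ on the shortest $s$-$t$ path in $G$ and every edge $d_2$ on the shortest $s$-$t$ path in $G-\{d_1\}$, the length of the shortest $s$-$t$ path in $G-\{d_1,d_2\}$). *)

(* Defs.v *)
(* World: Stdlib. *)
From Stdlib Require Import Reals ZArith List.
Import ListNotations.
Open Scope bool_scope.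
Open Scope Z_scope.

(** * Word RAM

    A structured presentation of the word RAM: a program uses finitely many
    registers and a random-access memory, every cell of which holds a signed
    [w]-bit word.  Overflow is a fault, i.e. the program has no execution; since
    the word length below is [k * (log2 n + 1)] for a constant [k] chosen
    together with the program, the model has words of O(log n) bits, and
    arithmetic modulo a smaller power of two can be programmed explicitly. *)

Definition is_word (w : nat) (z : Z) : bool :=
  (- 2 ^ (Z.of_nat w - 1) <=? z) && (z <? 2 ^ (Z.of_nat w - 1)).

Definition word (w : nat) (z : Z) : option Z :=
  if is_word w z then Some z else None.

Inductive binop : Set :=
  | Add | Sub | Mul | Div | Mod | And | Or | Xor | Shl | Shr | Less | Equal.

Definition binop_sem (o : binop) : Z -> Z -> Z :=
  match o with
  | Add => Z.add | Sub => Z.sub | Mul => Z.mul | Div => Z.div | Mod => Z.modulo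
  | And => Z.land | Or => Z.lor | Xor => Z.lxor
  | Shl => Z.shiftl | Shr => Z.shiftr
  | Less => fun a b => Z.b2z (a <? b)
  | Equal => fun a b => Z.b2z (a =? b)
  end.

Inductive expr : Set :=
  | Const (z : Z)
  | Reg (r : nat)
  | Read (address : expr)
  | Op (o : binop) (e1 e2 : expr).

Inductive cmd : Set :=
  | Skip
  | Assign (r : nat) (e : expr)
  | Write (address e : expr)
  | Seq (p q : cmd)
  | If (e : expr) (p q : cmd)
  | While (e : expr) (p : cmd).

(** Memory is addressed by words, which are signed, hence the index set [Z]. *)
Record state := State { reg : nat -> Z; mem : Z -> Z }.

Definition set_reg (s : state) (r : nat) (v : Z) : state :=
  State (fun r' => if Nat.eqb r' r then v else reg s r') (mem s).

Definition set_mem (s : state) (a v : Z) : state :=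
  State (reg s) (fun a' => if a' =? a then v else mem s a').

Fixpoint eval (w : nat) (s : state) (e : expr) : option Z :=
  match e with
  | Const z => word w z
  | Reg r => word w (reg s r)
  | Read e1 =>
      match eval w s e1 with
      | Some a => word w (mem s a)
      | None => None
      end
  | Op o e1 e2 =>
      match eval w s e1, eval w s e2 with
      | Some a, Some b => word w (binop_sem o a b)
      | _, _ => None
      end
  end.

Fixpoint cost (e : expr) : nat :=
  match e with
  | Const _ | Reg _ => 1
  | Read e1 => 1 + cost e1
  | Op _ e1 e2 => 1 + cost e1 + cost e2
  end.

(** [exec w p s T s']: with word length [w], program [p] started in state [s]
    halts without fault in state [s'] after exactly [T] unit-cost steps. *)
Inductive exec (w : nat) : cmd -> state -> nat -> state -> Prop :=
  | exec_skip s : exec w Skip s 1 s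
  | exec_assign s r e v :
      eval w s e = Some v ->
      exec w (Assign r e) s (1 + cost e) (set_reg s r v)
  | exec_write s e1 e2 a v :
      eval w s e1 = Some a -> eval w s e2 = Some v ->
      exec w (Write e1 e2) s (1 + cost e1 + cost e2) (set_mem s a v)
  | exec_seq s s1 s2 p q T1 T2 :
      exec w p s T1 s1 -> exec w q s1 T2 s2 ->
      exec w (Seq p q) s (T1 + T2) s2
  | exec_if_true s s1 e p q v T :
      eval w s e = Some v -> v <> 0 -> exec w p s T s1 ->
      exec w (If e p q) s (1 + cost e + T) s1
  | exec_if_false s s1 e p q T :
      eval w s e = Some 0 -> exec w q s T s1 ->
      exec w (If e p q) s (1 + cost e + T) s1
  | exec_while_true s s1 s2 e p v T1 T2 :
      eval w s e = Some v -> v <> 0 -> exec w p s T1 s1 ->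
      exec w (While e p) s1 T2 s2 ->
      exec w (While e p) s (1 + cost e + T1 + T2) s2
  | exec_while_false s e p :
      eval w s e = Some 0 ->
      exec w (While e p) s (1 + cost e) s.

(** The input occupies the memory cells 0, 1, 2, ...; all other cells and all
    registers are initially 0.  The output is read off the same cells. *)
Definition initial (input : list Z) : state :=
  State (fun _ => 0)
        (fun a => if a <? 0 then 0 else nth (Z.to_nat a) input 0).

Definition holds_output (s : state) (output : list Z) : Prop :=
  forall i, (i < length output)%nat -> mem s (Z.of_nat i) = nth i output 0.

(** * Computational problems

    [valid c x] says that [x] is a legitimate instance whose weights have
    absolute value at most [n ^ c], where [n = size x]. *)
Record problem := Problem {
  instance : Type;
  size : instance -> nat;
  valid : nat -> instance -> Prop;
  encode : instance -> list Z;
  correct : instance -> list Z -> Prop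
}.

(** [P] can be solved in time O(f(n)) on a word RAM with O(log n)-bit words,
    for integer weights bounded by any fixed polynomial in [n].  As usual for
    this model, the program may depend on the degree [c] of that polynomial. *)
Definition solvable_in_time (P : problem) (f : nat -> R) : Prop :=
  forall c : nat,
  exists (prog : cmd) (k : nat) (C : R),
  forall x : instance P, valid P c x ->
  exists (T : nat) (s : state) (output : list Z),
    exec (k * (Nat.log2 (size P x) + 1)) prog (initial (encode P x)) T s /\
    (INR T <= C * f (size P x))%R /\
    holds_output s output /\
    correct P x output.

(** * Weighted graphs

    The vertices are 0, ..., [order - 1]; [weight u v = None] means that there
    is no edge from [u] to [v].  Values of [weight] outside the vertex range
    are irrelevant. *)
Record graph := Graph { order : nat; weight : nat -> nat -> option Z }.

Definition loopless (G : graph) : Prop :=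
  forall u, (u < order G)%nat -> weight G u u = None.

Definition undirected (G : graph) : Prop :=
  forall u v, (u < order G)%nat -> (v < order G)%nat ->
    weight G u v = weight G v u.

Definition weights_within (G : graph) (lo hi : Z) : Prop :=
  forall u v z, (u < order G)%nat -> (v < order G)%nat ->
    weight G u v = Some z -> lo <= z <= hi.

(** [walk G u v p l]: [p] is the vertex list of a walk from [u] to [v] of total
    weight [l]. *)
Inductive walk (G : graph) : nat -> nat -> list nat -> Z -> Prop :=
  | walk_nil u : (u < order G)%nat -> walk G u u [u] 0
  | walk_cons u x v p z l :
      (u < order G)%nat -> weight G u x = Some z -> walk G x v p l ->
      walk G u v (u :: p) (z + l).

Definition path (G : graph) (u v : nat) (p : list nat) (l : Z) : Prop :=
  walk G u v p l /\ NoDup p.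

Definition no_path (G : graph) (u v : nat) : Prop :=
  forall p l, ~ path G u v p l.

Definition shortest_path (G : graph) (u v : nat) (p : list nat) (l : Z) : Prop :=
  path G u v p l /\ forall p' l', path G u v p' l' -> l <= l'.

(** [None] stands for an infinite distance. *)
Definition is_distance (G : graph) (u v : nat) (d : option Z) : Prop :=
  match d with
  | Some l => exists p, shortest_path G u v p l
  | None => no_path G u v
  end.

Definition no_negative_cycle (G : graph) : Prop :=
  forall u p l, walk G u u p l -> 0 <= l.

Definition edges (p : list nat) : list (nat * nat) := combine p (tl p).

(** Deletion of the undirected edge [{fst e, snd e}]. *)
Definition delete (G : graph) (e : nat * nat) : graph :=
  let (a, b) := e in
  Graph (order G) (fun u v =>
    if ((u =? a)%nat && (v =? b)%nat) || ((u =? b)%nat && (v =? a)%nat)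
    then None else weight G u v).

Definition encode_option (d : option Z) : list Z :=
  match d with Some l => [1; l] | None => [0; 0] end.

Definition encode_matrix (n : nat) (M : nat -> nat -> option Z) : list Z :=
  flat_map (fun u => flat_map (fun v => encode_option (M u v)) (seq 0 n))
           (seq 0 n).

Definition encode_path (p : list nat) : list Z :=
  Z.of_nat (length p) :: map Z.of_nat p.

(** * All-pairs shortest paths (directed, no negative cycles) *)

Definition APSP : problem := {|
  instance := graph;
  size := order;
  valid := fun c G =>
    (1 <= order G)%nat /\ loopless G /\ no_negative_cycle G /\
    weights_within G (- Z.of_nat (order G ^ c)) (Z.of_nat (order G ^ c));
  encode := fun G => Z.of_nat (order G) :: encode_matrix (order G) (weight G);
  correct := fun G output =>
    exists D : nat -> nat -> option Z,
      output = encode_matrix (order G) D /\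
      forall u v, (u < order G)%nat -> (v < order G)%nat ->
        is_distance G u v (D u v)
|}.

(** * 2-fault replacement paths in undirected graphs

    There can be about n^4 sets of at most two edges, so the answer is given in
    the usual compact form: a shortest s-t path [p] of [G] and its length; for
    each edge [e1] of [p], in order, a shortest s-t path [p1] of [G - e1] and
    its length; and for each edge [e2] of [p1], in order, the s-t distance in
    [G - e1 - e2].  The distance in [G - F] for every other [F] with at most
    two edges is one of the listed ones.  [None] replaces a path (and
    everything below it) when [s] and [t] are disconnected. *)

Definition row : Type := option (Z * list nat * list (option Z)).
Definition answer : Type := option (Z * list nat * list row).

Definition row_correct (G : graph) (s t : nat) (r : row) : Prop :=
  match r with
  | None => no_path G s t
  | Some (l, p, ds) =>
      shortest_path G s t p l /\
      Forall2 (fun e d => is_distance (delete G e) s t d) (edges p) ds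
  end.

Definition answer_correct (G : graph) (s t : nat) (a : answer) : Prop :=
  match a with
  | None => no_path G s t
  | Some (l, p, rs) =>
      shortest_path G s t p l /\
      Forall2 (fun e r => row_correct (delete G e) s t r) (edges p) rs
  end.

Definition encode_row (r : row) : list Z :=
  match r with
  | None => [0]
  | Some (l, p, ds) => 1 :: l :: encode_path p ++ flat_map encode_option ds
  end.

Definition encode_answer (a : answer) : list Z :=
  match a with
  | None => [0]
  | Some (l, p, rs) => 1 :: l :: encode_path p ++ flat_map encode_row rs
  end.

Record st_graph := StGraph { graph_of : graph; source : nat; target : nat }.

Definition TwoFRP : problem := {|
  instance := st_graph;
  size := fun x => order (graph_of x);
  valid := fun c x =>
    let G := graph_of x in
    (source x < order G)%nat /\ (target x < order G)%nat /\
    loopless G /\ undirected G /\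
    weights_within G 0 (Z.of_nat (order G ^ c));
  encode := fun x =>
    let G := graph_of x in
    Z.of_nat (order G) :: Z.of_nat (source x) :: Z.of_nat (target x) ::
    encode_matrix (order G) (weight G);
  correct := fun x output =>
    exists a : answer,
      output = encode_answer a /\
      answer_correct (graph_of x) (source x) (target x) a
|}.

Definition subcubic (eps : R) (n : nat) : R := Rpower (INR n) (3 - eps).

Definition APSP_hardness_conjecture : Prop :=
  forall eps : R, (0 < eps)%R -> ~ solvable_in_time APSP (subcubic eps).

(* Main.v *)
(** All-pairs distances are computed by about [log2 n] squarings of the
    distance matrix [D] in the (min,+) semiring, and a squaring costs a single
    2FRP query on [3n + 1] vertices.  The query graph is a path [0 .. 2n] of
    weight 0 together with [n] further vertices [2n + 1 + k], each joined to
    every path vertex [i] by an edge of weight [W + 2W |n - i| + X i k], where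
    [X] lists the rows of [D] for [i < n] and its columns for [i > n], and
    where [0 <= X < W].  When the path edges [(i, i+1)] and [(n+j, n+j+1)] fail,
    it is cheapest to leave the path as late and to rejoin it as early as
    possible, so that the distance from [0] to [2n] is
    [2W + 2W (n - i + j + 1) + min_k (D i k + D k j)].  When only [(i, i+1)]
    fails, the shortest path is [0 .. i], [2n + 1 + k], [n .. 2n] for some [k];
    hence the lengths of all blocks of the answer, and the cells that hold the
    entries of the product, are known in advance.  Lower bounds on distances
    come from potentials, and shapes of shortest paths from tight edges.

    The 2FRP program is run by relocating its registers and its memory, each
    time into a part of the memory that still contains zeros only. *)

From Stdlib Require Import Reals ZArith List Lia Lra Bool Arith.
Import ListNotations.
Require Import Defs.
Open Scope bool_scope.
Open Scope Z_scope.

(** * Walks, potentials and tight edges *)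

Lemma walk_start G u v p l : walk G u v p l -> (u < order G)%nat /\ exists q, p = u :: q.
Proof. intros H; destruct H; eauto. Qed.

Lemma walk_end G u v p l : walk G u v p l -> (v < order G)%nat.
Proof. induction 1; auto. Qed.

Lemma walk_in_order G u v p l : walk G u v p l -> forall x, In x p -> (x < order G)%nat.
Proof.
  induction 1; simpl; intros y [<-|Hy]; auto; try contradiction.
Qed.

Lemma walk_app G u v x p q l m :
  walk G u v p l -> walk G v x q m -> walk G u x (p ++ tl q) (l + m).
Proof.
  intros H; revert q m; induction H as [u Hu|u y v p z l Hu Hw H IH]; intros q m Hq.
  - destruct (walk_start _ _ _ _ _ Hq) as [_ [q' ->]]; exact Hq.
  - simpl; rewrite <- Z.add_assoc; econstructor; eauto.
Qed.

Lemma walk_suffix G u v p l x :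
  walk G u v p l -> In x p ->
  exists p1 p2 l1 l2, walk G u x p1 l1 /\ walk G x v p2 l2 /\ l = l1 + l2 /\
    p = removelast p1 ++ p2.
Proof.
  intros H; induction H as [u Hu|u y v p z l Hu Hw H IH]; intros Hx.
  - destruct Hx as [<-|[]]. exists [u], [u], 0, 0; repeat split; auto; constructor; auto.
  - destruct (Nat.eq_dec x u) as [->|Hne].
    + exists [u], (u :: p), 0, (z + l); repeat split; auto; econstructor; eauto.
    + destruct Hx as [->|Hx]; [contradiction|].
      destruct (IH Hx) as (p1 & p2 & l1 & l2 & H1 & H2 & -> & Hp).
      destruct (walk_start _ _ _ _ _ H1) as [_ [q Hq]].
      exists (u :: p1), p2, (z + l1), l2; repeat split; auto.
      * econstructor; eauto.
      * lia.
      * rewrite Hp; subst p1; reflexivity.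
Qed.

Lemma walk_to_path G u v p l :
  no_negative_cycle G -> walk G u v p l ->
  exists p' l', path G u v p' l' /\ l' <= l.
Proof.
  intros Hc H; induction H as [u Hu|u y v p z l Hu Hw H IH].
  - exists [u], 0; repeat split; try lia; repeat constructor; auto.
  - destruct IH as (p' & l' & [Hp Hn] & Hle).
    destruct (in_dec Nat.eq_dec u p') as [Hin|Hin].
    + destruct (walk_suffix _ _ _ _ _ _ Hp Hin) as (p1 & p2 & l1 & l2 & H1 & H2 & -> & ->).
      exists p2, l2; split; [split; auto|].
      * apply NoDup_app_remove_l in Hn; auto.
      * assert (0 <= z + l1) by (apply (Hc u (u :: p1)); econstructor; eauto). lia.
    + exists (u :: p'), (z + l'); split; [split|lia].
      * econstructor; eauto.
      * constructor; auto.
Qed.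

Lemma nodup_length_bound n (p : list nat) :
  NoDup p -> (forall x, In x p -> (x < n)%nat) -> (length p <= n)%nat.
Proof.
  intros Hn Hb; rewrite <- (length_seq n 0).
  apply NoDup_incl_length; auto. intros x Hx; apply in_seq; specialize (Hb x Hx); lia.
Qed.

Lemma nonneg_no_negative_cycle G :
  (forall u v z, (u < order G)%nat -> (v < order G)%nat -> weight G u v = Some z -> 0 <= z) ->
  no_negative_cycle G.
Proof.
  intros Hw u; generalize u at 2; intros v p l H.
  induction H; [lia|].
  destruct (walk_start _ _ _ _ _ H1) as [Hx _].
  specialize (Hw _ _ _ H Hx H0); lia.
Qed.

Lemma is_distance_some G u v d p l :
  no_negative_cycle G -> is_distance G u v d -> walk G u v p l ->
  exists m, d = Some m /\ m <= l /\ exists q, walk G u v q m.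
Proof.
  intros Hc Hd H.
  destruct (walk_to_path _ _ _ _ _ Hc H) as (p' & l' & Hp & Hle).
  destruct d as [m|]; [|exfalso; exact (Hd _ _ Hp)].
  destruct Hd as [q [[Hq _] Hmin]].
  exists m; split; [auto|split; [specialize (Hmin _ _ Hp); lia|eauto]].
Qed.

Definition feasible (G : graph) (phi : nat -> Z) : Prop :=
  forall u x z, (u < order G)%nat -> (x < order G)%nat ->
    weight G u x = Some z -> phi u <= z + phi x.

Lemma potential_bound G phi u v p l :
  feasible G phi -> walk G u v p l -> phi u - phi v <= l.
Proof.
  intros Hf H; induction H as [u Hu|u y v p z l Hu Hw H IH]; [lia|].
  destruct (walk_start _ _ _ _ _ H) as [Hy _].
  specialize (Hf _ _ _ Hu Hy Hw); lia.
Qed.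

Definition tight_graph (G : graph) (phi : nat -> Z) : graph :=
  Graph (order G) (fun u x =>
    match weight G u x with
    | Some z =>
        if (x <? order G)%nat && (phi u =? z + phi x) then Some z else None
    | None => None
    end).

Lemma tight_weight G phi u x z :
  weight (tight_graph G phi) u x = Some z ->
  weight G u x = Some z /\ (x < order G)%nat /\ phi u = z + phi x.
Proof.
  simpl; destruct (weight G u x) as [y|]; [|discriminate].
  destruct (Nat.ltb_spec x (order G)); [|discriminate].
  destruct (Z.eqb_spec (phi u) (y + phi x)); [|discriminate].
  intros [= <-]; auto.
Qed.

Lemma tight_walk G phi u v p l :
  feasible G phi -> walk G u v p l -> l <= phi u - phi v ->
  walk (tight_graph G phi) u v p l.
Proof.
  intros Hf H; induction H as [u Hu|u y v p z l Hu Hw H IH]; intros Hl.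
  - constructor; auto.
  - destruct (walk_start _ _ _ _ _ H) as [Hy _].
    pose proof (Hf _ _ _ Hu Hy Hw).
    pose proof (potential_bound _ _ _ _ _ _ Hf H).
    econstructor; auto.
    + simpl; rewrite Hw, (proj2 (Nat.ltb_lt _ _) Hy), (proj2 (Z.eqb_eq _ _)); auto; lia.
    + apply IH; lia.
Qed.

Lemma line_path_shape G m x p l :
  (forall u v z, (x <= u <= m)%nat -> weight G u v = Some z ->
     (v = S u /\ (v <= m)%nat) \/ u = S v) ->
  (forall y, x = S y -> ~ In y p) ->
  (x <= m)%nat -> path G x m p l -> p = seq x (m + 1 - x).
Proof.
  intros Hw Hy Hx [H Hn].
  remember m as v eqn:E in H.
  induction H as [u Hu|u y v p z l Hu Hwt H IH].
  - replace (m + 1 - u)%nat with 1%nat by lia; reflexivity.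
  - subst v; inversion Hn as [|? ? Hni Hn']; subst.
    destruct (walk_start _ _ _ _ _ H) as [_ [q Hq]].
    destruct (Hw u y z ltac:(lia) Hwt) as [[-> Hm]|E].
    + rewrite IH; auto.
      * replace (m + 1 - u)%nat with (S (m + 1 - S u))%nat by lia; reflexivity.
      * intros; eapply Hw; eauto; lia.
      * intros w [= <-]; auto.
    + exfalso; apply (Hy y E); right; rewrite Hq; left; auto.
Qed.

Lemma delete_weight G a b u v z :
  weight (delete G (a, b)) u v = Some z <->
  weight G u v = Some z /\ ~ (u = a /\ v = b) /\ ~ (u = b /\ v = a).
Proof.
  simpl.
  destruct (Nat.eqb_spec u a), (Nat.eqb_spec v b), (Nat.eqb_spec u b), (Nat.eqb_spec v a);
    simpl; subst; intuition congruence.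
Qed.

Lemma nth_edges p i :
  (S i < length p)%nat -> nth i (edges p) (0, 0)%nat = (nth i p 0, nth (S i) p 0)%nat.
Proof.
  unfold edges; revert i; induction p as [|x p IH]; simpl; intros i Hi; [lia|].
  destruct p as [|y p]; simpl in *; [lia|].
  destruct i; [reflexivity|]. rewrite <- IH by lia. reflexivity.
Qed.

Lemma length_edges p : length (edges p) = (length p - 1)%nat.
Proof.
  unfold edges; rewrite length_combine; destruct p; cbn [length tl]; lia.
Qed.

Lemma Forall2_nth {A B} (P : A -> B -> Prop) l m a b i :
  Forall2 P l m -> (i < length l)%nat -> P (nth i l a) (nth i m b).
Proof.
  intros H; revert i; induction H; simpl; intros i Hi; [lia|].
  destruct i; auto; apply IHForall2; lia.
Qed.

Lemma argmin (f : nat -> Z) n :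
  (1 <= n)%nat -> exists k, (k < n)%nat /\ forall k', (k' < n)%nat -> f k <= f k'.
Proof.
  induction n as [|n IH]; [lia|]; intros _.
  destruct (Nat.eq_dec n 0) as [->|Hn].
  - exists 0%nat; split; [lia|]; intros k' ?; replace k' with 0%nat by lia; lia.
  - destruct IH as (k & Hk & Hmin); [lia|].
    destruct (Z_le_gt_dec (f k) (f n)).
    + exists k; split; [lia|]; intros k' ?.
      destruct (Nat.eq_dec k' n) as [->|]; [lia|apply Hmin; lia].
    + exists n; split; [lia|]; intros k' ?.
      destruct (Nat.eq_dec k' n) as [->|]; [lia|].
      specialize (Hmin k' ltac:(lia)); lia.
Qed.

(** * The query graph *)

Section Gadget.

Context (n : nat) (W : Z) (X : nat -> nat -> Z).

Definition crossing (i k : nat) : Z :=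
  W + 2 * W * Z.abs (Z.of_nat n - Z.of_nat i) + X i k.

Definition gadget_weight (u v : nat) : option Z :=
  let lo := Nat.min u v in
  let hi := Nat.max u v in
  if (hi <=? 2 * n)%nat then if (hi =? S lo)%nat then Some 0 else None
  else if (lo <=? 2 * n)%nat then Some (crossing lo (hi - (2 * n + 1))) else None.

Definition gadget : graph := Graph (3 * n + 1) gadget_weight.

Context (n_pos : (1 <= n)%nat) (W_pos : 0 < W).
Context (X_range : forall i k, (i <= 2 * n)%nat -> (k < n)%nat -> 0 <= X i k < W).
Context (X_mid : forall k, (k < n)%nat -> X n k = 0).

Lemma gadget_weight_sym u v : gadget_weight u v = gadget_weight v u.
Proof. unfold gadget_weight; rewrite Nat.min_comm, Nat.max_comm; reflexivity. Qed.

Lemma gadget_weight_cases u v z :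
  gadget_weight u v = Some z ->
  ((u <= 2 * n)%nat /\ (v <= 2 * n)%nat /\ (v = S u \/ u = S v) /\ z = 0) \/
  ((u <= 2 * n)%nat /\ exists k, v = (2 * n + 1 + k)%nat /\ z = crossing u k) \/
  ((v <= 2 * n)%nat /\ exists k, u = (2 * n + 1 + k)%nat /\ z = crossing v k).
Proof.
  unfold gadget_weight.
  destruct (Nat.leb_spec (Nat.max u v) (2 * n)).
  - destruct (Nat.eqb_spec (Nat.max u v) (S (Nat.min u v))); intros [= <-].
    left; lia.
  - destruct (Nat.leb_spec (Nat.min u v) (2 * n)); intros [= <-]; right.
    destruct (Nat.le_gt_cases u v).
    + left; split; [lia|]; exists (v - (2 * n + 1))%nat; split; [lia|].
      rewrite Nat.min_l, Nat.max_r by lia; reflexivity.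
    + right; split; [lia|]; exists (u - (2 * n + 1))%nat; split; [lia|].
      rewrite Nat.min_r, Nat.max_l by lia; reflexivity.
Qed.

Lemma gadget_weight_line i : (i < 2 * n)%nat -> gadget_weight i (S i) = Some 0.
Proof.
  intros; unfold gadget_weight; rewrite Nat.min_l, Nat.max_r by lia.
  destruct (Nat.leb_spec (S i) (2 * n)); [|lia]. rewrite Nat.eqb_refl; reflexivity.
Qed.

Lemma gadget_weight_out i k :
  (i <= 2 * n)%nat -> gadget_weight i (2 * n + 1 + k) = Some (crossing i k).
Proof.
  intros; unfold gadget_weight; rewrite Nat.min_l, Nat.max_r by lia.
  destruct (Nat.leb_spec (2 * n + 1 + k) (2 * n)); [lia|].
  destruct (Nat.leb_spec i (2 * n)); [|lia].
  do 2 f_equal; lia.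
Qed.

Lemma crossing_range i k :
  (i <= 2 * n)%nat -> (k < n)%nat -> W <= crossing i k < 2 * W * (1 + Z.of_nat n).
Proof.
  intros Hi Hk; unfold crossing; specialize (X_range i k Hi Hk).
  assert (0 <= Z.abs (Z.of_nat n - Z.of_nat i) <= Z.of_nat n) by lia. nia.
Qed.

Lemma gadget_weight_range u v z :
  (u < 3 * n + 1)%nat -> (v < 3 * n + 1)%nat -> gadget_weight u v = Some z ->
  0 <= z < 2 * W * (1 + Z.of_nat n).
Proof.
  intros Hu Hv H.
  apply gadget_weight_cases in H as
    [(? & ? & ? & ->)|[(? & k & -> & ->)|(? & k & -> & ->)]].
  - nia.
  - pose proof (crossing_range u k ltac:(lia) ltac:(lia)); lia.
  - pose proof (crossing_range v k ltac:(lia) ltac:(lia)); lia.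
Qed.

Lemma no_negative_cycle_sub G :
  order G = (3 * n + 1)%nat ->
  (forall u v z, weight G u v = Some z -> gadget_weight u v = Some z) ->
  no_negative_cycle G.
Proof.
  intros Ho Hs; apply nonneg_no_negative_cycle; rewrite Ho; intros u v z Hu Hv Hw.
  apply (gadget_weight_range u v); auto.
Qed.

Lemma line_walk G a d :
  order G = (3 * n + 1)%nat -> (a + d <= 2 * n)%nat ->
  (forall i, (a <= i < a + d)%nat -> weight G i (S i) = Some 0) ->
  exists p, walk G a (a + d) p 0.
Proof.
  intros Ho; revert a; induction d as [|d IH]; intros a Ha Hw.
  - exists [a]; rewrite Nat.add_0_r; constructor; lia.
  - destruct (IH (S a)) as [p Hp]; [lia|intros; apply Hw; lia|].
    exists (a :: p); rewrite <- Nat.add_succ_comm.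
    apply (walk_cons G a (S a) _ p 0 0); auto; [lia|apply Hw; lia].
Qed.

Lemma detour_walk G i y k :
  order G = (3 * n + 1)%nat -> (i < y <= 2 * n)%nat -> (k < n)%nat ->
  (forall x, (x < i \/ y <= x < 2 * n)%nat -> weight G x (S x) = Some 0) ->
  weight G i (2 * n + 1 + k) = Some (crossing i k) ->
  weight G (2 * n + 1 + k) y = Some (crossing y k) ->
  exists p, walk G 0 (2 * n) p (crossing i k + crossing y k).
Proof.
  intros Ho Hy Hk Hl H1 H2.
  destruct (line_walk G 0 i Ho) as [p Hp]; [lia|intros; apply Hl; lia|].
  destruct (line_walk G y (2 * n - y) Ho) as [q Hq]; [lia|intros; apply Hl; lia|].
  replace (y + (2 * n - y))%nat with (2 * n)%nat in Hq by lia.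
  simpl in Hp.
  eexists.
  replace (crossing i k + crossing y k)
    with (0 + (crossing i k + (crossing y k + 0))) by lia.
  eapply walk_app; [exact Hp|].
  eapply walk_cons; [lia|exact H1|]. eapply walk_cons; [lia|exact H2|exact Hq].
Qed.

Lemma gadget_path p l :
  shortest_path gadget 0 (2 * n) p l -> p = seq 0 (2 * n + 1).
Proof.
  intros [[H Hn] Hmin].
  assert (Hc : no_negative_cycle gadget) by (apply no_negative_cycle_sub; auto).
  destruct (line_walk gadget 0 (2 * n)) as [p0 Hp0]; simpl; auto.
  { intros; apply gadget_weight_line; lia. }
  destruct (walk_to_path _ _ _ _ _ Hc Hp0) as (p1 & l1 & Hp1 & Hl1).
  specialize (Hmin _ _ Hp1).
  assert (Hf : feasible gadget (fun _ => 0)).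
  { intros u v z Hu Hv Hw; pose proof (gadget_weight_range u v z Hu Hv Hw); lia. }
  apply (tight_walk _ _ _ _ _ _ Hf) in H; [|lia].
  rewrite (line_path_shape (tight_graph gadget (fun _ => 0)) (2 * n) 0 p l); auto.
  - f_equal; lia.
  - intros u v z Hu Hw; apply tight_weight in Hw as (Hw & Hv & Hz); simpl in Hv.
    destruct (gadget_weight_cases _ _ _ Hw) as
      [(? & ? & [->| ->] & ->)|[(? & k & -> & E)|(? & k & -> & E)]]; auto; try lia.
    pose proof (crossing_range u k ltac:(lia) ltac:(lia)); lia.
  - discriminate.
  - lia.
  - split; auto.
Qed.

Definition cut (i : nat) : graph := delete gadget (i, S i).
Definition cut2 (i j : nat) : graph := delete (cut i) ((n + j)%nat, S (n + j)).

Lemma cut_weight i u v z :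
  weight (cut i) u v = Some z <->
  gadget_weight u v = Some z /\ ~ (u = i /\ v = S i) /\ ~ (u = S i /\ v = i).
Proof. apply delete_weight. Qed.

Lemma cut2_weight i j u v z :
  weight (cut2 i j) u v = Some z <->
  (gadget_weight u v = Some z /\ ~ (u = i /\ v = S i) /\ ~ (u = S i /\ v = i)) /\
  ~ (u = (n + j)%nat /\ v = S (n + j)) /\ ~ (u = S (n + j) /\ v = (n + j)%nat).
Proof. unfold cut2; rewrite delete_weight, cut_weight; reflexivity. Qed.

Lemma cut_no_negative_cycle i : no_negative_cycle (cut i).
Proof. apply no_negative_cycle_sub; [reflexivity|]; intros u v z H; apply cut_weight in H; tauto. Qed.

Lemma cut2_no_negative_cycle i j : no_negative_cycle (cut2 i j).
Proof. apply no_negative_cycle_sub; [reflexivity|]; intros u v z H; apply cut2_weight in H; tauto. Qed.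

Lemma cut_detour i k :
  (i < n)%nat -> (k < n)%nat ->
  exists p, walk (cut i) 0 (2 * n) p (crossing i k + crossing n k).
Proof.
  intros Hi Hk; apply (detour_walk (cut i) i n k); auto; try lia.
  - intros x Hx; apply cut_weight; rewrite gadget_weight_line; repeat split; lia.
  - apply cut_weight; rewrite gadget_weight_out; repeat split; lia.
  - apply cut_weight; rewrite gadget_weight_sym, gadget_weight_out; repeat split; lia.
Qed.

Lemma cut2_detour i j k :
  (i < n)%nat -> (j < n)%nat -> (k < n)%nat ->
  exists p, walk (cut2 i j) 0 (2 * n) p (crossing i k + crossing (n + 1 + j) k).
Proof.
  intros Hi Hj Hk; apply (detour_walk (cut2 i j) i (n + 1 + j) k); auto; try lia.
  - intros x Hx; apply cut2_weight; rewrite gadget_weight_line; repeat split; lia.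
  - apply cut2_weight; rewrite gadget_weight_out; repeat split; lia.
  - apply cut2_weight; rewrite gadget_weight_sym, gadget_weight_out; repeat split; lia.
Qed.

Definition cut_potential (i : nat) (c : Z) (v : nat) : Z :=
  if (v <=? i)%nat then 2 * W + 2 * W * (Z.of_nat n - Z.of_nat i) + c
  else if (v <=? 2 * n)%nat then 0 else W.

Definition cut2_potential (i j : nat) (c : Z) (v : nat) : Z :=
  if (v <=? i)%nat then 2 * W + 2 * W * (Z.of_nat n - Z.of_nat i + Z.of_nat j + 1) + c
  else if (v <=? n + j)%nat then 2 * W + 2 * W * (Z.of_nat j + 1)
  else if (v <=? 2 * n)%nat then 0
  else W + 2 * W * (Z.of_nat j + 1) + X (n + 1 + j) (v - (2 * n + 1)).

Lemma crossing_before i x k :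
  (x < i)%nat -> (i <= n)%nat -> (k < n)%nat ->
  W + 2 * W * (Z.of_nat n - Z.of_nat i) + 2 * W <= crossing x k.
Proof.
  intros Hx Hi Hk; unfold crossing; pose proof (X_range x k ltac:(lia) Hk).
  rewrite Z.abs_eq by lia. nia.
Qed.

Lemma crossing_after y x k :
  (y < x <= 2 * n)%nat -> (n <= y)%nat -> (k < n)%nat ->
  W + 2 * W * (Z.of_nat y - Z.of_nat n) + 2 * W <= crossing x k.
Proof.
  intros Hx Hi Hk; unfold crossing; pose proof (X_range x k ltac:(lia) Hk).
  rewrite Z.abs_neq by lia. nia.
Qed.

Lemma crossing_left i k :
  (i <= n)%nat -> crossing i k = W + 2 * W * (Z.of_nat n - Z.of_nat i) + X i k.
Proof. intros; unfold crossing; rewrite Z.abs_eq by lia; reflexivity. Qed.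

Lemma crossing_right y k :
  (n <= y)%nat -> crossing y k = W + 2 * W * (Z.of_nat y - Z.of_nat n) + X y k.
Proof. intros; unfold crossing; rewrite Z.abs_neq by lia; f_equal; f_equal; lia. Qed.

Lemma cut_potential_feasible i c :
  (i < n)%nat -> 0 <= c -> (forall k, (k < n)%nat -> c <= X i k) ->
  feasible (cut i) (cut_potential i c).
Proof.
  intros Hi Hc0 Hc u v z Hu Hv Hw; simpl in Hu, Hv.
  pose proof (Hc 0%nat ltac:(lia)); pose proof (X_range i 0 ltac:(lia) ltac:(lia)).
  apply cut_weight in Hw as (Hw & Hu' & Hv'); unfold cut_potential.
  assert (0 <= W * (Z.of_nat n - Z.of_nat i)) by nia.
  destruct (gadget_weight_cases _ _ _ Hw) as
    [(? & ? & E & ->)|[(? & k & -> & ->)|(? & k & -> & ->)]].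
  - destruct (Nat.leb_spec u i), (Nat.leb_spec v i), (Nat.leb_spec u (2 * n)),
      (Nat.leb_spec v (2 * n)); lia.
  - destruct (Nat.leb_spec (2 * n + 1 + k) i), (Nat.leb_spec u i), (Nat.leb_spec u (2 * n)),
      (Nat.leb_spec (2 * n + 1 + k) (2 * n)); try lia.
    + destruct (Nat.eq_dec u i) as [->|].
      * rewrite crossing_left by lia. specialize (Hc k ltac:(lia)); lia.
      * pose proof (crossing_before i u k ltac:(lia) ltac:(lia) ltac:(lia)); lia.
    + pose proof (crossing_range u k ltac:(lia) ltac:(lia)); lia.
  - pose proof (crossing_range v k ltac:(lia) ltac:(lia)).
    destruct (Nat.leb_spec (2 * n + 1 + k) i), (Nat.leb_spec v i), (Nat.leb_spec v (2 * n)),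
      (Nat.leb_spec (2 * n + 1 + k) (2 * n)); lia.
Qed.

Lemma cut2_potential_feasible i j c :
  (i < n)%nat -> (j < n)%nat -> c < 2 * W -> 0 <= c ->
  (forall k, (k < n)%nat -> c <= X i k + X (n + 1 + j) k) ->
  feasible (cut2 i j) (cut2_potential i j c).
Proof.
  intros Hi Hj Hc2 Hc0 Hc u v z Hu Hv Hw; simpl in Hu, Hv.
  apply cut2_weight in Hw as ((Hw & Hu' & Hv') & Hu2 & Hv2); unfold cut2_potential.
  assert (0 <= W * (Z.of_nat n - Z.of_nat i)) by nia.
  assert (0 <= W * Z.of_nat j) by nia.
  destruct (gadget_weight_cases _ _ _ Hw) as
    [(? & ? & E & ->)|[(? & k & -> & ->)|(? & k & -> & ->)]].
  - destruct (Nat.leb_spec u i), (Nat.leb_spec v i), (Nat.leb_spec u (n + j)),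
     (Nat.leb_spec v (n + j)), (Nat.leb_spec u (2 * n)),
      (Nat.leb_spec v (2 * n)); lia.
  - pose proof (crossing_range u k ltac:(lia) ltac:(lia)).
    pose proof (X_range (n + 1 + j) k ltac:(lia) ltac:(lia)).
    replace (2 * n + 1 + k - (2 * n + 1))%nat with k by lia.
    destruct (Nat.leb_spec (2 * n + 1 + k) i), (Nat.leb_spec (2 * n + 1 + k) (n + j)),
      (Nat.leb_spec (2 * n + 1 + k) (2 * n)); try lia.
    specialize (Hc k ltac:(lia)).
    destruct (Nat.leb_spec u i), (Nat.leb_spec u (n + j)), (Nat.leb_spec u (2 * n)); try lia.
    destruct (Nat.eq_dec u i) as [->|].
    + rewrite crossing_left by lia. lia.
    + pose proof (crossing_before i u k ltac:(lia) ltac:(lia) ltac:(lia)); lia.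
  - pose proof (crossing_range v k ltac:(lia) ltac:(lia)).
    pose proof (X_range (n + 1 + j) k ltac:(lia) ltac:(lia)).
    replace (2 * n + 1 + k - (2 * n + 1))%nat with k by lia.
    destruct (Nat.leb_spec (2 * n + 1 + k) i), (Nat.leb_spec (2 * n + 1 + k) (n + j)),
      (Nat.leb_spec (2 * n + 1 + k) (2 * n)); try lia.
    destruct (Nat.leb_spec v i), (Nat.leb_spec v (n + j)), (Nat.leb_spec v (2 * n)); try lia.
    destruct (Nat.eq_dec v (n + 1 + j)) as [->|].
    + rewrite crossing_right by lia. lia.
    + pose proof (crossing_after (n + 1 + j) v k ltac:(lia) ltac:(lia) ltac:(lia)); lia.
Qed.

Lemma cut2_distance i j d :
  (i < n)%nat -> (j < n)%nat -> is_distance (cut2 i j) 0 (2 * n) d ->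
  exists c, d = Some (2 * W + 2 * W * (Z.of_nat n - Z.of_nat i + Z.of_nat j + 1) + c) /\
    (forall k, (k < n)%nat -> c <= X i k + X (n + 1 + j) k) /\
    exists k, (k < n)%nat /\ c = X i k + X (n + 1 + j) k.
Proof.
  intros Hi Hj Hd.
  destruct (argmin (fun k => X i k + X (n + 1 + j) k) n n_pos) as (k & Hk & Hmin).
  pose proof (X_range i k ltac:(lia) Hk); pose proof (X_range (n + 1 + j) k ltac:(lia) Hk).
  destruct (cut2_detour i j k Hi Hj Hk) as [p Hp].
  destruct (is_distance_some _ _ _ _ _ _ (cut2_no_negative_cycle i j) Hd Hp)
    as (m & -> & Hm & q & Hq).
  pose proof (potential_bound _ _ _ _ _ _
    (cut2_potential_feasible i j (X i k + X (n + 1 + j) k) Hi Hj ltac:(lia) ltac:(lia) Hmin) Hq) as Hb.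
  unfold cut2_potential in Hb.
  destruct (Nat.leb_spec 0 i), (Nat.leb_spec (2 * n) i), (Nat.leb_spec (2 * n) (n + j)),
    (Nat.leb_spec (2 * n) (2 * n)); try lia.
  rewrite crossing_left, crossing_right in Hm by lia.
  exists (X i k + X (n + 1 + j) k); split; [|split; eauto].
  f_equal; lia.
Qed.

Lemma no_return (G : graph) i v p l :
  (forall u x z, (i < u < n)%nat -> weight G u x = Some z -> (i < x <= n)%nat) ->
  walk G v (2 * n) p l -> (i < v < n)%nat -> In n p.
Proof.
  intros Hw H; remember (2 * n)%nat as t eqn:E in H.
  induction H as [u Hu|u y v p z l Hu Hwt H IH]; intros Hn; [lia|].
  destruct (walk_start _ _ _ _ _ H) as [_ [q Hq]].
  pose proof (Hw _ _ _ Hn Hwt); right.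
  destruct (Nat.eq_dec y n) as [->|]; [rewrite Hq; left; auto|apply IH; auto; lia].
Qed.

Definition detour_path (i k : nat) : list nat :=
  seq 0 (i + 1) ++ (2 * n + 1 + k)%nat :: seq n (n + 1).

Lemma detour_shape (G : graph) i x p l :
  (i < n)%nat ->
  (forall u v z, (u <= i)%nat -> weight G u v = Some z ->
     ((v <= i)%nat /\ (v = S u \/ u = S v)) \/
     (u = i /\ exists k, (k < n)%nat /\ v = (2 * n + 1 + k)%nat)) ->
  (forall u v z, (i < u <= 2 * n)%nat -> weight G u v = Some z ->
     (i < v <= 2 * n)%nat /\ (v = S u \/ u = S v)) ->
  (forall u v z, (2 * n < u < order G)%nat -> weight G u v = Some z -> v = n) ->
  (forall y, x = S y -> ~ In y p) -> (x <= i)%nat -> path G x (2 * n) p l ->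
  exists k, (k < n)%nat /\ p = seq x (i + 1 - x) ++ (2 * n + 1 + k)%nat :: seq n (n + 1).
Proof.
  intros Hi H1 H2 H3 Hy Hx [H Hn]; remember (2 * n)%nat as t eqn:E in H.
  induction H as [u Hu|u y v p z l Hu Hwt H IH]; [lia|subst v].
  destruct (walk_start _ _ _ _ _ H) as [_ [q Hq]].
  inversion Hn as [|? ? Hni Hn']; subst.
  destruct (H1 _ _ _ Hx Hwt) as [(Hle & [->|E])|(-> & k & Hk & ->)].
  - destruct IH as (k & Hk & Hp); auto.
    { intros w [= <-]; auto. }
    exists k; split; auto. rewrite Hp.
    replace (i + 1 - u)%nat with (S (i + 1 - S u)) by lia; reflexivity.
  - exfalso; apply (Hy y E); right; left; auto.
  - exists k; split; auto. replace (i + 1 - i)%nat with 1%nat by lia; simpl; do 2 f_equal.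
    inversion H as [|? y ? p z' l' Hu' Hw' H']; subst; [lia|].
    apply H3 in Hw'; [|lia]; subst y.
    inversion Hn' as [|? ? Hni2 Hn2]; subst.
    destruct (walk_start _ _ _ _ _ H') as [_ [q' Hq']]; subst q.
    replace (n + 1)%nat with (2 * n + 1 - n)%nat by lia.
    apply (line_path_shape G (2 * n) n _ l'); auto; [| |lia|split; auto].
    + intros u v w Hu2 Hw2; destruct (H2 u v w ltac:(lia) Hw2) as [? [->| ->]]; auto; lia.
    + intros y Ey Hin.
      assert (Hyn : (y < n <= S y)%nat) by lia; clear Ey.
      inversion H' as [|? y2 ? p2 z2 l2 Hu2 Hw2 H2']; subst; [lia|].
      destruct Hin as [Hin|Hin]; [lia|].
      destruct (walk_suffix _ _ _ _ _ _ H2' Hin) as (p1 & p3 & l1 & l3 & _ & Hp3 & _ & ->).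
      destruct (Nat.eq_dec y i) as [->|Hyi]; [apply Hni; right; right; exact Hin|].
      inversion Hn2 as [|? ? Hni3 _]; subst; apply Hni3, in_or_app; right.
      apply (no_return G i y p3 l3); auto; [|lia].
      intros u v w Hu3 Hw3; destruct (H2 u v w ltac:(lia) Hw3) as [? [->| ->]]; lia.
Qed.

Lemma cut_path i p l :
  (i < n)%nat -> shortest_path (cut i) 0 (2 * n) p l ->
  exists k, (k < n)%nat /\ p = detour_path i k.
Proof.
  intros Hi [[H Hn] Hmin].
  destruct (argmin (X i) n n_pos) as (k0 & Hk0 & Hk0min).
  pose proof (X_range i k0 ltac:(lia) Hk0).
  destruct (cut_detour i k0 Hi Hk0) as [p0 Hp0].
  destruct (walk_to_path _ _ _ _ _ (cut_no_negative_cycle i) Hp0) as (p1 & l1 & Hp1 & Hl1).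
  specialize (Hmin _ _ Hp1).
  rewrite (crossing_left i), (crossing_left n), X_mid in Hl1 by lia.
  assert (Hf : feasible (cut i) (cut_potential i (X i k0)))
    by (apply cut_potential_feasible; auto; lia).
  apply (tight_walk _ _ _ _ _ _ Hf) in H.
  2:{ unfold cut_potential.
      destruct (Nat.leb_spec 0 i), (Nat.leb_spec (2 * n) i), (Nat.leb_spec (2 * n) (2 * n)); lia. }
  assert (0 <= W * (Z.of_nat n - Z.of_nat i)) by nia.
  unfold detour_path; replace (i + 1)%nat with (i + 1 - 0)%nat by lia.
  apply (detour_shape (tight_graph (cut i) (cut_potential i (X i k0))) i 0 p l);
    auto; try lia; try discriminate; try (split; assumption).
  - intros u v z Hu Hw; apply tight_weight in Hw as (Hw & Hv & Ht); simpl in Hv.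
    apply cut_weight in Hw as (Hw & Hn1 & Hn2); revert Ht; unfold cut_potential.
    destruct (gadget_weight_cases _ _ _ Hw) as
      [(? & ? & E & ->)|[(? & k & -> & ->)|(? & k & -> & ->)]]; try lia.
    destruct (Nat.leb_spec (2 * n + 1 + k) i), (Nat.leb_spec u i),
      (Nat.leb_spec (2 * n + 1 + k) (2 * n)); try lia; intros Ht; right.
    destruct (Nat.eq_dec u i) as [->|].
    + split; auto; exists k; split; auto; lia.
    + pose proof (crossing_before i u k ltac:(lia) ltac:(lia) ltac:(lia)); lia.
  - intros u v z Hu Hw; apply tight_weight in Hw as (Hw & Hv & Ht); simpl in Hv.
    apply cut_weight in Hw as (Hw & Hn1 & Hn2); revert Ht; unfold cut_potential.
    destruct (gadget_weight_cases _ _ _ Hw) as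
      [(? & ? & E & ->)|[(? & k & -> & ->)|(? & k & -> & ->)]]; try lia.
    pose proof (crossing_range u k ltac:(lia) ltac:(lia)).
    destruct (Nat.leb_spec (2 * n + 1 + k) i), (Nat.leb_spec u i), (Nat.leb_spec u (2 * n)),
      (Nat.leb_spec (2 * n + 1 + k) (2 * n)); lia.
  - intros u v z Hu Hw; simpl in Hu.
    apply tight_weight in Hw as (Hw & Hv & Ht); simpl in Hv.
    apply cut_weight in Hw as (Hw & Hn1 & Hn2); revert Ht; unfold cut_potential.
    destruct (gadget_weight_cases _ _ _ Hw) as
      [(? & ? & E & ->)|[(? & k & -> & ->)|(? & k & -> & ->)]]; try lia.
    pose proof (crossing_range v k ltac:(lia) ltac:(lia)).
    destruct (Nat.leb_spec (2 * n + 1 + k) i), (Nat.leb_spec v i), (Nat.leb_spec v (2 * n)),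
      (Nat.leb_spec (2 * n + 1 + k) (2 * n)); try lia; intros Ht.
    destruct (Nat.lt_total v n) as [?|[?|?]]; auto.
    + pose proof (crossing_before n v k ltac:(lia) ltac:(lia) ltac:(lia)); lia.
    + pose proof (crossing_after n v k ltac:(lia) ltac:(lia) ltac:(lia)); lia.
Qed.
End Gadget.

(** * Layout of the answer *)

Lemma firstn_snoc {A} (l : list A) i d :
  (i < length l)%nat -> firstn (S i) l = firstn i l ++ [nth i l d].
Proof.
  revert i; induction l as [|x l IH]; simpl; intros i Hi; [lia|].
  destruct i; simpl; [reflexivity|f_equal; apply IH; lia].
Qed.

Lemma nth_flat_map {A} (f : A -> list Z) l i b d :
  (i < length l)%nat -> (b < length (f (nth i l d)))%nat ->
  nth (length (flat_map f (firstn i l)) + b) (flat_map f l) 0 = nth b (f (nth i l d)) 0.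
Proof.
  intros Hi Hb. rewrite <- (firstn_skipn (S i) l) at 2.
  rewrite (firstn_snoc l i d Hi), !flat_map_app; simpl; rewrite app_nil_r.
  rewrite <- app_assoc, app_nth2_plus, app_nth1; auto.
Qed.

Lemma length_flat_map_option ds : length (flat_map encode_option ds) = (2 * length ds)%nat.
Proof. induction ds as [|[z|] ds IH]; simpl; lia. Qed.

Definition option_cell (d : option Z) (b : nat) : Z := nth b (encode_option d) 0.

Lemma nth_flat_map_option ds m b :
  (b < 2)%nat -> (m < length ds)%nat ->
  nth (2 * m + b) (flat_map encode_option ds) 0 = option_cell (nth m ds None) b.
Proof.
  revert m; induction ds as [|d ds IH]; intros m Hb Hm; simpl in Hm; [lia|].
  destruct m as [|m].
  - simpl; rewrite app_nth1; [reflexivity|destruct d; simpl; lia].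
  - replace (2 * S m + b)%nat with (2 + (2 * m + b))%nat by lia.
    simpl nth at 2; rewrite <- IH by lia.
    destruct d; reflexivity.
Qed.

Lemma encode_matrix_eq n M :
  encode_matrix n M =
  flat_map encode_option (flat_map (fun u => map (M u) (seq 0 n)) (seq 0 n)).
Proof.
  unfold encode_matrix; generalize (seq 0 n) at 2 4; intros l; induction l as [|u l IH]; auto.
  simpl; rewrite flat_map_app, IH; f_equal.
  generalize (seq 0 n); intros l'; induction l' as [|v l' IH']; simpl; congruence.
Qed.

Lemma length_rows {A} (M : nat -> nat -> A) n l :
  length (flat_map (fun u => map (M u) (seq 0 n)) l) = (length l * n)%nat.
Proof. induction l; simpl; rewrite ?length_app, ?length_map, ?length_seq; lia. Qed.

Lemma length_encode_matrix n M : length (encode_matrix n M) = (2 * (n * n))%nat.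
Proof. rewrite encode_matrix_eq, length_flat_map_option, length_rows, length_seq; reflexivity. Qed.

Lemma nth_rows {A} (M : nat -> nat -> A) n a m u v d :
  (u < m)%nat -> (v < n)%nat ->
  nth (u * n + v) (flat_map (fun u => map (M u) (seq 0 n)) (seq a m)) d = M (a + u)%nat v.
Proof.
  revert a u; induction m as [|m IH]; intros a u Hu Hv; [lia|].
  cbn [seq flat_map]; destruct u as [|u].
  - simpl; rewrite app_nth1 by (rewrite length_map, length_seq; lia).
    rewrite (nth_indep _ d (M a 0%nat)) by (rewrite length_map, length_seq; lia).
    rewrite map_nth, seq_nth by lia; rewrite Nat.add_0_r; reflexivity.
  - rewrite app_nth2; rewrite length_map, length_seq; [|nia].
    replace (S u * n + v - n)%nat with (u * n + v)%nat by nia.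
    rewrite IH by lia; f_equal; lia.
Qed.

Lemma nth_encode_matrix n M u v b :
  (u < n)%nat -> (v < n)%nat -> (b < 2)%nat ->
  nth (2 * (u * n + v) + b) (encode_matrix n M) 0 = option_cell (M u v) b.
Proof.
  intros Hu Hv Hb; rewrite encode_matrix_eq, nth_flat_map_option; auto.
  - rewrite nth_rows; auto.
  - rewrite length_rows, length_seq; nia.
Qed.

Section Layout.

Context (n : nat) (W : Z) (X : nat -> nat -> Z).
Context (n_pos : (1 <= n)%nat) (W_pos : 0 < W).
Context (X_range : forall i k, (i <= 2 * n)%nat -> (k < n)%nat -> 0 <= X i k < W).
Context (X_mid : forall k, (k < n)%nat -> X n k = 0).

Definition row_offset (i : nat) : nat := (i * (3 * n + 10) + 3 * (i * (i - 1) / 2))%nat.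

Definition answer_index (i j : nat) : nat :=
  ((2 * n + 4) + (row_offset i + ((n + i + 6) + (2 * (i + 2 + j) + 1))))%nat.

Lemma row_offset_S i : row_offset (S i) = (row_offset i + (3 * n + 3 * i + 10))%nat.
Proof.
  unfold row_offset.
  replace (S i * (S i - 1))%nat with (i * (i - 1) + i * 2)%nat by nia.
  rewrite Nat.div_add by lia; nia.
Qed.

Lemma length_detour_path i k : length (detour_path n i k) = (n + i + 3)%nat.
Proof. unfold detour_path; rewrite length_app; simpl; rewrite !length_seq; lia. Qed.

Lemma nth_detour_path i k m :
  (m <= n)%nat -> nth (i + 2 + m) (detour_path n i k) 0%nat = (n + m)%nat.
Proof.
  intros Hm; unfold detour_path; rewrite app_nth2; rewrite length_seq; [|lia].
  replace (i + 2 + m - (i + 1))%nat with (S m) by lia.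
  cbn [nth]; rewrite seq_nth; lia.
Qed.

Lemma row_layout i r :
  (i < n)%nat -> row_correct (cut n W X i) 0 (2 * n) r ->
  length (encode_row r) = (3 * n + 3 * i + 10)%nat /\
  forall j, (j < n)%nat -> exists d,
    is_distance (cut2 n W X i j) 0 (2 * n) d /\
    nth ((n + i + 6) + (2 * (i + 2 + j) + 1)) (encode_row r) 0 = option_cell d 1.
Proof.
  intros Hi Hr; destruct r as [[[l p] ds]|].
  - destruct Hr as [Hs Hd].
    destruct (cut_path n W X n_pos W_pos X_range X_mid i p l Hi Hs) as (k & Hk & ->).
    pose proof (Forall2_length Hd) as Hlen.
    rewrite length_edges, length_detour_path in Hlen.
    unfold encode_row, encode_path; split.
    + cbn [length app]. rewrite length_app, length_map, length_detour_path, length_flat_map_option.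
      lia.
    + intros j Hj; exists (nth (i + 2 + j) ds None); split.
      * pose proof (Forall2_nth _ _ _ (0, 0)%nat None (i + 2 + j) Hd) as H.
        rewrite length_edges, length_detour_path in H; specialize (H ltac:(lia)).
        rewrite nth_edges, nth_detour_path in H by (rewrite ?length_detour_path; lia).
        replace (S (i + 2 + j)) with (i + 2 + S j)%nat in H by lia.
        rewrite nth_detour_path, <- plus_n_Sm in H by lia; exact H.
      * replace (n + i + 6 + (2 * (i + 2 + j) + 1))%nat with
          (3 + (length (map Z.of_nat (detour_path n i k)) + (2 * (i + 2 + j) + 1)))%nat
          by (rewrite length_map, length_detour_path; lia).
        cbn [nth app Nat.add]. rewrite app_nth2_plus.
        apply nth_flat_map_option; lia.
  - exfalso; destruct (cut_detour n W X n_pos i 0) as [p Hp]; try lia.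
    destruct (walk_to_path _ _ _ _ _ (cut_no_negative_cycle n W X n_pos W_pos X_range i) Hp)
      as (q & m & Hq & _).
    exact (Hr _ _ Hq).
Qed.

Lemma answer_layout a i j :
  answer_correct (gadget n W X) 0 (2 * n) a -> (i < n)%nat -> (j < n)%nat ->
  exists d, is_distance (cut2 n W X i j) 0 (2 * n) d /\
    nth (answer_index i j) (encode_answer a) 0 = option_cell d 1.
Proof.
  intros Ha Hi Hj; destruct a as [[[l p] rs]|].
  - destruct Ha as [Hs Hr].
    apply gadget_path in Hs; auto; subst p.
    pose proof (Forall2_length Hr) as Hlen.
    rewrite length_edges, length_seq in Hlen.
    assert (Hrow : forall i', (i' < n)%nat ->
      row_correct (cut n W X i') 0 (2 * n) (nth i' rs None)).
    { intros i' Hi'.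
      pose proof (Forall2_nth _ _ _ (0, 0)%nat None i' Hr) as H.
      rewrite length_edges, length_seq in H; specialize (H ltac:(lia)).
      rewrite nth_edges, !seq_nth in H by (rewrite ?length_seq; lia); exact H. }
    assert (Hoff : forall i', (i' <= n)%nat ->
      length (flat_map encode_row (firstn i' rs)) = row_offset i').
    { induction i' as [|i' IH]; intros Hi'; [reflexivity|].
      rewrite (firstn_snoc rs i' None), flat_map_app, length_app, IH, row_offset_S by lia.
      simpl; rewrite app_nil_r.
      rewrite (proj1 (row_layout i' _ ltac:(lia) (Hrow i' ltac:(lia)))); reflexivity. }
    destruct (row_layout i _ Hi (Hrow i Hi)) as [Hl Hd].
    destruct (Hd j Hj) as (d & Hd1 & Hd2).
    exists d; split; auto.
    rewrite <- Hd2; unfold answer_index, encode_answer, encode_path.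
    replace (2 * n + 4)%nat with (3 + length (map Z.of_nat (seq 0 (2 * n + 1))))%nat
      by (rewrite length_map, length_seq; lia).
    rewrite <- Nat.add_assoc.
    cbn [nth app Nat.add]. rewrite app_nth2_plus, <- (Hoff i) by lia.
    apply nth_flat_map; lia.
  - exfalso; destruct (line_walk n n_pos (gadget n W X) 0 (2 * n)) as [p Hp]; auto.
    { intros; apply gadget_weight_line; lia. }
    destruct (walk_to_path (gadget n W X) _ _ _ _
      (no_negative_cycle_sub n W X n_pos W_pos X_range (gadget n W X) eq_refl (fun _ _ _ H => H)) Hp)
      as (q & m & Hq & _).
    exact (Ha _ _ Hq).
Qed.

Lemma answer_value a i j :
  answer_correct (gadget n W X) 0 (2 * n) a -> (i < n)%nat -> (j < n)%nat ->
  exists c, (answer_index i j < length (encode_answer a))%nat /\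
    nth (answer_index i j) (encode_answer a) 0 =
      2 * W + 2 * W * (Z.of_nat n - Z.of_nat i + Z.of_nat j + 1) + c /\
    (forall k, (k < n)%nat -> c <= X i k + X (n + 1 + j) k) /\
    exists k, (k < n)%nat /\ c = X i k + X (n + 1 + j) k.
Proof.
  intros Ha Hi Hj.
  destruct (answer_layout a i j Ha Hi Hj) as (d & Hd & Hn).
  destruct (cut2_distance n W X n_pos W_pos X_range i j d Hi Hj Hd) as (c & -> & Hmin & k & Hk & Hc).
  exists c; split; [|split; [exact Hn|split; eauto]].
  destruct (Nat.lt_ge_cases (answer_index i j) (length (encode_answer a))) as [|Hge]; auto.
  rewrite (nth_overflow _ _ Hge) in Hn; cbn [option_cell encode_option nth] in Hn.
  pose proof (X_range i k ltac:(lia) Hk); pose proof (X_range (n + 1 + j) k ltac:(lia) Hk).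
  assert (0 <= W * (Z.of_nat n - Z.of_nat i + Z.of_nat j + 1)) by nia. lia.
Qed.

End Layout.

(** * Squaring distance matrices *)

Lemma walk_cut_in_two G u v p l a b :
  walk G u v p l -> (length p <= a + b + 1)%nat ->
  exists k p1 p2 l1 l2, walk G u k p1 l1 /\ walk G k v p2 l2 /\ l = l1 + l2 /\
    (length p1 <= a + 1)%nat /\ (length p2 <= b + 1)%nat.
Proof.
  intros H; revert a; induction H as [u Hu|u y v p z l Hu Hw H IH]; intros a Hl.
  - exists u, [u], [u], 0, 0; repeat split; try (constructor; auto); simpl; lia.
  - destruct a as [|a].
    + exists u, [u], (u :: p), 0, (z + l); repeat split; auto.
      * constructor; auto.
      * econstructor; eauto.
    + simpl in Hl; destruct (IH a ltac:(lia)) as (k & p1 & p2 & l1 & l2 & H1 & H2 & -> & L1 & L2).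
      exists k, (u :: p1), p2, (z + l1), l2; repeat split; auto.
      * econstructor; eauto.
      * lia.
      * simpl; lia.
Qed.

Lemma walk_weight_bound G u v p l w :
  weights_within G (- w) w -> walk G u v p l ->
  Z.abs l <= (Z.of_nat (length p) - 1) * w.
Proof.
  intros Hb H; induction H as [u Hu|u y v p z l Hu Hw H IH].
  - simpl; lia.
  - destruct (walk_start _ _ _ _ _ H) as [Hy _].
    specialize (Hb _ _ _ Hu Hy Hw); cbn [length]; nia.
Qed.

(* Distances [l] are stored as [l + B] in [0 .. 2B], and infinity as [4B + 1],
   which exceeds every sum of two finite entries. *)
Definition represents (G : graph) (B : Z) (R : nat) (D : nat -> nat -> Z) : Prop :=
  forall u v, (u < order G)%nat -> (v < order G)%nat ->
    ((0 <= D u v <= 2 * B /\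
      exists p, walk G u v p (D u v - B) /\ (length p <= R + 1)%nat) \/
     D u v = 4 * B + 1) /\
    forall p l, walk G u v p l -> (length p <= R + 1)%nat -> D u v <= l + B.

Lemma represents_range G B R D u v :
  0 <= B -> represents G B R D -> (u < order G)%nat -> (v < order G)%nat ->
  0 <= D u v < 4 * B + 2.
Proof. intros HB H Hu Hv; destruct (H u v Hu Hv) as [[[? _]|?] _]; lia. Qed.

Definition first_entry (B : Z) (G : graph) (u v : nat) : Z :=
  if (u =? v)%nat then B
  else match weight G u v with Some z => z + B | None => 4 * B + 1 end.

Lemma represents_init G B :
  loopless G -> weights_within G (- B) B -> 0 <= B ->
  represents G B 1 (first_entry B G).
Proof.
  intros Hll Hb HB u v Hu Hv; unfold first_entry.
  destruct (Nat.eqb_spec u v) as [->|Huv].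
  - split.
    + left; split; [lia|]; exists [v]; rewrite Z.sub_diag; split; [constructor; auto|simpl; lia].
    + intros p l H Hl; inversion H as [|? y ? q z m Hu' Hw H']; subst; [lia|].
      inversion H' as [|? y' ? q' z' m' Hu2 Hw2 H2']; subst.
      * rewrite Hll in Hw by auto; discriminate.
      * destruct (walk_start _ _ _ _ _ H2') as [_ [q ->]]; simpl in Hl; lia.
  - split.
    + destruct (weight G u v) as [z|] eqn:Hw; [left|right; reflexivity].
      specialize (Hb _ _ _ Hu Hv Hw).
      split; [lia|]; exists [u; v]; split; [|simpl; lia].
      replace (z + B - B) with (z + 0) by lia.
      econstructor; eauto; constructor; auto.
    + intros p l H Hl; inversion H as [|? y ? q z m Hu' Hw H']; subst; [lia|].
      inversion H' as [|? y' ? q' z' m' Hu2 Hw2 H2']; subst.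
      * rewrite Hw; lia.
      * destruct (walk_start _ _ _ _ _ H2') as [_ [q ->]]; simpl in Hl; lia.
Qed.

Definition clip (B c : Z) : Z := if c <? 4 * B + 1 then c - B else 4 * B + 1.

Lemma represents_square G B w R D (C : nat -> nat -> Z) :
  weights_within G (- w) w -> 2 * Z.of_nat R * w <= B -> 0 <= w ->
  represents G B R D ->
  (forall u v, (u < order G)%nat -> (v < order G)%nat ->
     (forall k, (k < order G)%nat -> C u v <= D u k + D k v) /\
     exists k, (k < order G)%nat /\ C u v = D u k + D k v) ->
  represents G B (2 * R) (fun u v => clip B (C u v)).
Proof.
  intros Hb HB Hw HD HC u v Hu Hv.
  destruct (HC u v Hu Hv) as [Hmin (k & Hk & Hc)].
  assert (Hlen : forall p l, walk G u v p l -> (length p <= 2 * R + 1)%nat -> - B <= l <= B).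
  { intros p l H Hl; pose proof (walk_weight_bound _ _ _ _ _ _ Hb H). nia. }
  assert (HB0 : 0 <= B) by nia.
  pose proof (represents_range _ _ _ _ u k HB0 HD Hu Hk).
  pose proof (represents_range _ _ _ _ k v HB0 HD Hk Hv).
  unfold clip; split.
  - destruct (Z.ltb_spec (C u v) (4 * B + 1)); [left|right; reflexivity].
    destruct (HD u k Hu Hk) as [[[? (p & Hp & Lp)]|?] _]; [|lia].
    destruct (HD k v Hk Hv) as [[[? (q & Hq & Lq)]|?] _]; [|lia].
    pose proof (walk_app _ _ _ _ _ _ _ _ Hp Hq) as Hpq.
    assert (L : (length (p ++ tl q) <= 2 * R + 1)%nat).
    { rewrite length_app, length_tl. lia. }
    pose proof (Hlen _ _ Hpq L).
    split; [lia|]. exists (p ++ tl q); split; auto.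
    replace (C u v - B - B) with (D u k - B + (D k v - B)) by lia; auto.
  - intros p l H1 L.
    pose proof (Hlen _ _ H1 L).
    destruct (walk_cut_in_two _ _ _ _ _ R R H1 ltac:(lia))
      as (k' & p1 & p2 & l1 & l2 & Hp1 & Hp2 & -> & L1 & L2).
    assert (Hk' : (k' < order G)%nat) by apply (walk_end _ _ _ _ _ Hp1).
    pose proof (proj2 (HD u k' Hu Hk') _ _ Hp1 L1).
    pose proof (proj2 (HD k' v Hk' Hv) _ _ Hp2 L2).
    specialize (Hmin k' Hk').
    destruct (Z.ltb_spec (C u v) (4 * B + 1)); lia.
Qed.

Definition decode (B x : Z) : option Z := if x <? 4 * B + 1 then Some (x - B) else None.

Lemma represents_distance G B w R D u v :
  no_negative_cycle G -> weights_within G (- w) w ->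
  Z.of_nat (order G) * w <= B -> 0 <= w -> (order G <= R + 1)%nat -> represents G B R D ->
  (u < order G)%nat -> (v < order G)%nat ->
  is_distance G u v (decode B (D u v)).
Proof.
  intros Hc Hb HB Hw HR HD Hu Hv.
  assert (Hp : forall p l, path G u v p l -> D u v <= l + B /\ l <= B).
  { intros p l [Hp Hn].
    assert (length p <= order G)%nat
      by (apply nodup_length_bound; auto; apply (walk_in_order _ _ _ _ _ Hp)).
    split.
    - apply (proj2 (HD u v Hu Hv) _ _ Hp); lia.
    - pose proof (walk_weight_bound _ _ _ _ _ _ Hb Hp); nia. }
  unfold decode; destruct (Z.ltb_spec (D u v) (4 * B + 1)).
  - destruct (HD u v Hu Hv) as [[[_ (p & Hp' & _)]|?] _]; [|lia].
    destruct (walk_to_path _ _ _ _ _ Hc Hp') as (q & m & Hq & Hm).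
    destruct (Hp _ _ Hq).
    replace (D u v - B) with m by lia.
    exists q; split; auto; intros p' l' H'; destruct (Hp _ _ H'); lia.
  - intros p l H'; destruct (Hp _ _ H'). nia.
Qed.

(** * Programs *)

Definition fits (w : nat) (z : Z) : Prop :=
  - 2 ^ (Z.of_nat w - 1) <= z < 2 ^ (Z.of_nat w - 1).

Lemma word_some w z v : word w z = Some v <-> z = v /\ fits w v.
Proof.
  unfold word, is_word, fits.
  destruct (Z.leb_spec (- 2 ^ (Z.of_nat w - 1)) z), (Z.ltb_spec z (2 ^ (Z.of_nat w - 1)));
    simpl; split; try (intros [= <-]); try (intros [<- ?]); auto; try discriminate; lia.
Qed.

Lemma eval_fits w s e v : eval w s e = Some v -> fits w v.
Proof.
  destruct e as [z|r|e|o e1 e2]; simpl; intros H.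
  - apply word_some in H; tauto.
  - apply word_some in H; tauto.
  - destruct (eval w s e); [apply word_some in H; tauto|discriminate].
  - destruct (eval w s e1), (eval w s e2); try discriminate; apply word_some in H; tauto.
Qed.

Lemma eval_const w s z : fits w z -> eval w s (Const z) = Some z.
Proof. intros; apply word_some; auto. Qed.

Lemma eval_reg w s r v : reg s r = v -> fits w v -> eval w s (Reg r) = Some v.
Proof. intros; apply word_some; auto. Qed.

Lemma eval_read w s e a v :
  eval w s e = Some a -> mem s a = v -> fits w v -> eval w s (Read e) = Some v.
Proof. simpl; intros -> ? ?; apply word_some; auto. Qed.

Lemma eval_op w s o e1 e2 a b v :
  eval w s e1 = Some a -> eval w s e2 = Some b -> binop_sem o a b = v -> fits w v ->
  eval w s (Op o e1 e2) = Some v.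
Proof. simpl; intros -> -> ? ?; apply word_some; auto. Qed.

Lemma fits_between w a b z : fits w a -> fits w b -> a <= z <= b -> fits w z.
Proof. unfold fits; lia. Qed.

Lemma fits_zero w : fits w 1 -> fits w 0.
Proof. unfold fits; lia. Qed.

Lemma fits_bool w b : fits w 1 -> fits w (Z.b2z b).
Proof. unfold fits; destruct b; simpl; lia. Qed.

Lemma eval_less w s e1 e2 a b :
  fits w 1 -> eval w s e1 = Some a -> eval w s e2 = Some b ->
  eval w s (Op Less e1 e2) = Some (Z.b2z (a <? b)).
Proof. intros; eapply eval_op; eauto; apply fits_bool; auto. Qed.

Lemma eval_equal w s e1 e2 a b :
  fits w 1 -> eval w s e1 = Some a -> eval w s e2 = Some b ->
  eval w s (Op Equal e1 e2) = Some (Z.b2z (a =? b)).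
Proof. intros; eapply eval_op; eauto; apply fits_bool; auto. Qed.

Definition select (c a b : expr) : expr :=
  Op Add (Op Mul c a) (Op Mul (Op Sub (Const 1) c) b).

Lemma eval_select w s c a b (t : bool) x y :
  fits w 1 -> eval w s c = Some (Z.b2z t) -> eval w s a = Some x -> eval w s b = Some y ->
  eval w s (select c a b) = Some (if t then x else y).
Proof.
  intros H1 Hc Ha Hb.
  pose proof (fits_zero w H1).
  pose proof (eval_fits _ _ _ _ Ha); pose proof (eval_fits _ _ _ _ Hb).
  assert (Hn : eval w s (Op Sub (Const 1) c) = Some (Z.b2z (negb t))).
  { eapply eval_op; [apply eval_const; auto|exact Hc|destruct t; reflexivity|].
    apply fits_bool; auto. }
  eapply eval_op; [eapply eval_op; [exact Hc|exact Ha|reflexivity|]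
                  |eapply eval_op; [exact Hn|exact Hb|reflexivity|]| |].
  all: destruct t; cbn [Z.b2z negb binop_sem]; rewrite ?Z.mul_1_l, ?Z.mul_0_l, ?Z.add_0_r, ?Z.add_0_l; auto.
Qed.

Fixpoint power (e : expr) (k : nat) : expr :=
  match k with O => Const 1 | S k => Op Mul e (power e k) end.

Lemma eval_power w s e k a :
  eval w s e = Some a -> 1 <= a -> fits w (a ^ Z.of_nat k) ->
  eval w s (power e k) = Some (a ^ Z.of_nat k).
Proof.
  intros He Ha; induction k as [|k IH]; intros Hf; [apply eval_const; exact Hf|].
  rewrite Nat2Z.inj_succ, Z.pow_succ_r in * by lia.
  assert (1 <= a ^ Z.of_nat k) by (apply (Z.pow_le_mono_r a 0); lia).
  eapply eval_op; [exact He|apply IH|reflexivity|exact Hf].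
  unfold fits in *; nia.
Qed.

Definition runs (w : nat) (p : cmd) (s : state) (c : nat) (P : state -> Prop) : Prop :=
  exists T s', exec w p s T s' /\ (T <= c)%nat /\ P s'.

Lemma runs_weaken w p s c c' (P P' : state -> Prop) :
  runs w p s c P -> (c <= c')%nat -> (forall s', P s' -> P' s') -> runs w p s c' P'.
Proof. intros (T & s' & H & HT & HP) Hc HP'; exists T, s'; repeat split; auto; lia. Qed.

Lemma runs_bound w p s c c' (P : state -> Prop) :
  runs w p s c P -> (c <= c')%nat -> runs w p s c' P.
Proof. intros H Hc; eapply runs_weaken; eauto. Qed.

Lemma runs_assign w s r e v (P : state -> Prop) :
  eval w s e = Some v -> P (set_reg s r v) -> runs w (Assign r e) s (1 + cost e) P.
Proof. intros; do 2 eexists; repeat split; [constructor; eauto|lia|auto]. Qed.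

Lemma runs_write w s e1 e2 a v (P : state -> Prop) :
  eval w s e1 = Some a -> eval w s e2 = Some v -> P (set_mem s a v) ->
  runs w (Write e1 e2) s (1 + cost e1 + cost e2) P.
Proof. intros; do 2 eexists; repeat split; [econstructor; eauto|lia|auto]. Qed.

Lemma runs_seq w p q s c1 c2 (P Q : state -> Prop) :
  runs w p s c1 P -> (forall s', P s' -> runs w q s' c2 Q) ->
  runs w (Seq p q) s (c1 + c2) Q.
Proof.
  intros (T1 & s1 & H1 & L1 & HP) H.
  destruct (H s1 HP) as (T2 & s2 & H2 & L2 & HQ).
  do 2 eexists; repeat split; [econstructor; eauto|lia|auto].
Qed.

Lemma runs_assign_seq w s r e v q c (P : state -> Prop) :
  eval w s e = Some v -> runs w q (set_reg s r v) c P ->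
  runs w (Seq (Assign r e) q) s (1 + cost e + c) P.
Proof.
  intros; apply runs_seq with (P := eq (set_reg s r v)); [eapply runs_assign; eauto|intros s' <-; auto].
Qed.

Lemma runs_write_seq w s e1 e2 a v q c (P : state -> Prop) :
  eval w s e1 = Some a -> eval w s e2 = Some v -> runs w q (set_mem s a v) c P ->
  runs w (Seq (Write e1 e2) q) s (1 + cost e1 + cost e2 + c) P.
Proof.
  intros; apply runs_seq with (P := eq (set_mem s a v)); [eapply runs_write; eauto|intros s' <-; auto].
Qed.

Lemma runs_while w e p c (I : nat -> state -> Prop) :
  (forall m s, I (S m) s -> eval w s e = Some 1 /\ runs w p s c (I m)) ->
  (forall s, I O s -> eval w s e = Some 0) ->
  forall m s, I m s ->
  runs w (While e p) s (m * (1 + cost e + c) + (1 + cost e)) (I O).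
Proof.
  intros Hs H0; induction m as [|m IH]; intros s H.
  - do 2 eexists; repeat split; [apply exec_while_false; auto|lia|auto].
  - destruct (Hs m s H) as [Hg (T1 & s1 & H1 & L1 & HI)].
    destruct (IH s1 HI) as (T2 & s2 & H2 & L2 & HQ).
    do 2 eexists; repeat split; [eapply exec_while_true; eauto; lia|lia|auto].
Qed.

Definition fill (count dst val : expr) : cmd :=
  Seq (Assign 7 (Const 0))
      (While (Op Less (Reg 7) count)
         (Seq (Write (Op Add dst (Reg 7)) val)
              (Assign 7 (Op Add (Reg 7) (Const 1))))).

Definition filled (s : state) (d : Z) (q : nat) (f : nat -> Z) (s' : state) : Prop :=
  (forall r, r <> 7%nat -> reg s' r = reg s r) /\ reg s' 7%nat = Z.of_nat q /\
  (forall i, (i < q)%nat -> mem s' (d + Z.of_nat i) = f i) /\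
  (forall a, ~ (d <= a < d + Z.of_nat q) -> mem s' a = mem s a).

Lemma fill_runs w s count dst val m d f :
  fits w 1 -> fits w d -> fits w (d + Z.of_nat m) ->
  (forall q s', (q <= m)%nat -> filled s d q f s' ->
     eval w s' count = Some (Z.of_nat m) /\ eval w s' dst = Some d /\
     ((q < m)%nat -> eval w s' val = Some (f q))) ->
  runs w (fill count dst val) s ((m + 1) * (12 + cost count + cost dst + cost val))
    (filled s d m f).
Proof.
  intros H1 Hd Hdm H.
  assert (Hf0 : filled s d 0 f (set_reg s 7 0)).
  { split; [|split; [|split]].
    - intros r Hr; simpl; destruct (Nat.eqb_spec r 7); auto; contradiction.
    - reflexivity.
    - lia.
    - reflexivity. }
  assert (Hm : fits w (Z.of_nat m)).
  { apply (eval_fits w (set_reg s 7 0) count). apply (H 0%nat); auto; lia. }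
  assert (Hq : forall q, (q <= m)%nat -> fits w (Z.of_nat q)).
  { intros q L; apply (fits_between w 0 (Z.of_nat m)); auto; [apply fits_zero; auto|lia]. }
  eapply runs_weaken; [eapply runs_seq|..].
  - eapply runs_assign; [apply eval_const, fits_zero; auto|].
    exact Hf0.
  - intros s0 Hs0.
    apply (runs_while w _ _ (5 + cost dst + cost val + 4) (fun k s' =>
      (k <= m)%nat /\ filled s d (m - k) f s')) with (m := m).
    + intros k s' [Hk Hs'].
      destruct (H (m - S k)%nat s' ltac:(lia) Hs') as (Hc & Hdst & Hval).
      specialize (Hval ltac:(lia)).
      pose proof (Hq (m - S k)%nat ltac:(lia)) as Hqf.
      destruct Hs' as (Hr & H7 & Hin & Hout).
      assert (Hq' : eval w s' (Reg 7) = Some (Z.of_nat (m - S k))) by (apply eval_reg; auto).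
      split.
      { erewrite eval_less; eauto. f_equal. rewrite (proj2 (Z.ltb_lt _ _)); auto; lia. }
      eapply runs_bound; [eapply (runs_seq _ _ _ _ _ _
        (eq (set_mem s' (d + Z.of_nat (m - S k)) (f (m - S k)%nat))))|..].
      * eapply runs_write; [|exact Hval|].
        { eapply eval_op; [exact Hdst|exact Hq'|reflexivity|].
          apply (fits_between w d (d + Z.of_nat m)); auto; simpl; lia. }
        reflexivity.
      * intros s2 Hs2. eapply runs_assign.
        { eapply eval_op; [|apply eval_const; auto|reflexivity|].
          - apply eval_reg; [rewrite <- Hs2; exact H7|auto].
          - simpl; replace (Z.of_nat (m - S k) + 1) with (Z.of_nat (m - k)) by lia.
            apply Hq; lia. }
        split; [lia|rewrite <- Hs2]; split; [|split; [|split]]; simpl.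
        -- intros r L; destruct (Nat.eqb_spec r 7); [contradiction|auto].
        -- lia.
        -- intros i L; destruct (Z.eqb_spec (d + Z.of_nat i) (d + Z.of_nat (m - S k))).
           ++ f_equal; lia.
           ++ apply Hin; lia.
        -- intros a L; destruct (Z.eqb_spec a (d + Z.of_nat (m - S k))); [lia|].
           apply Hout; lia.
      * cbn [cost]; lia.
    + intros s' [_ Hs'].
      destruct (H (m - 0)%nat s' ltac:(lia) Hs') as (Hc & _ & _).
      destruct Hs' as (_ & H7 & _).
      erewrite eval_less; eauto; [|apply eval_reg; [exact H7|apply Hq; lia]].
      f_equal. rewrite (proj2 (Z.ltb_ge _ _)); auto; lia.
    + split; auto. rewrite Nat.sub_diag; exact Hs0.
  - cbn [cost]; nia.
  - intros s' [_ Hs']; rewrite Nat.sub_0_r in Hs'; exact Hs'.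
Qed.

Fixpoint relocate_expr (e : expr) : expr :=
  match e with
  | Const z => Const z
  | Reg r => Reg (8 + r)
  | Read e => Read (Op Add (Reg 5) (relocate_expr e))
  | Op o e1 e2 => Op o (relocate_expr e1) (relocate_expr e2)
  end.

(* Runs [p] on the registers from 8 upwards and the memory around the address
   held in register 5. *)
Fixpoint relocate (p : cmd) : cmd :=
  match p with
  | Skip => Skip
  | Assign r e => Assign (8 + r) (relocate_expr e)
  | Write e1 e2 => Write (Op Add (Reg 5) (relocate_expr e1)) (relocate_expr e2)
  | Seq p q => Seq (relocate p) (relocate q)
  | If e p q => If (relocate_expr e) (relocate p) (relocate q)
  | While e p => While (relocate_expr e) (relocate p)
  end.

Fixpoint expr_regs (e : expr) : nat :=
  match e with
  | Const _ => 0
  | Reg r => S r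
  | Read e => expr_regs e
  | Op _ e1 e2 => Nat.max (expr_regs e1) (expr_regs e2)
  end.

Fixpoint cmd_regs (p : cmd) : nat :=
  match p with
  | Skip => 0
  | Assign r e => Nat.max (S r) (expr_regs e)
  | Write e1 e2 => Nat.max (expr_regs e1) (expr_regs e2)
  | Seq p q => Nat.max (cmd_regs p) (cmd_regs q)
  | If e p q => Nat.max (expr_regs e) (Nat.max (cmd_regs p) (cmd_regs q))
  | While e p => Nat.max (expr_regs e) (cmd_regs p)
  end.

Definition simulates (m : nat) (b Q : Z) (s t : state) : Prop :=
  (forall r, (r < m)%nat -> reg t (8 + r) = reg s r) /\ reg t 5%nat = b /\
  (forall a, - Q <= a < Q -> mem t (b + a) = mem s a).

Definition frame (b Q : Z) (t t' : state) : Prop :=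
  (forall r, (r < 8)%nat -> reg t' r = reg t r) /\
  (forall a, ~ (b - Q <= a < b + Q) -> mem t' a = mem t a).

Lemma frame_refl b Q t : frame b Q t t.
Proof. split; auto. Qed.

Lemma frame_trans b Q t1 t2 t3 : frame b Q t1 t2 -> frame b Q t2 t3 -> frame b Q t1 t3.
Proof. intros [H1 H2] [H3 H4]; split; intros; [rewrite H3, H1|rewrite H4, H2]; auto. Qed.

Lemma relocate_cost e : (cost (relocate_expr e) <= 3 * cost e)%nat.
Proof. induction e; simpl in *; lia. Qed.

Section Relocation.

Context (w w' m : nat) (b Q : Z).
Context (small : forall z, fits w z -> - Q <= z < Q).
Context (b_fits : fits w' b).
Context (Q_fits : forall z, - Q <= z < Q -> fits w' z).
Context (bQ_fits : forall z, - Q <= z < Q -> fits w' (b + z)).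

Lemma relocate_eval s t e v :
  simulates m b Q s t -> (expr_regs e <= m)%nat ->
  eval w s e = Some v -> eval w' t (relocate_expr e) = Some v.
Proof.
  intros (Hr & Hb & Hm); revert v; induction e as [z|r|e IH|o e1 IH1 e2 IH2]; intros v Hle He.
  - apply word_some in He as [-> Hf]; apply eval_const; auto.
  - apply word_some in He as [<- Hf]; apply eval_reg; auto.
  - cbn [eval] in He; destruct (eval w s e) as [a|] eqn:Ea; [|discriminate].
    apply word_some in He as [<- Hf].
    pose proof (eval_fits _ _ _ _ Ea).
    cbn [relocate_expr]; eapply eval_read; [|apply Hm; auto|auto].
    eapply eval_op; [apply eval_reg; eauto|apply IH; auto|reflexivity|apply bQ_fits; auto].
  - cbn [expr_regs] in Hle; cbn [eval] in He.
    destruct (eval w s e1) as [a1|]; [|discriminate].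
    destruct (eval w s e2) as [a2|]; [|discriminate].
    apply word_some in He as [<- Hf].
    eapply eval_op; [apply IH1; auto; lia|apply IH2; auto; lia|reflexivity|auto].
Qed.

Lemma relocate_exec p s T s' :
  exec w p s T s' -> (cmd_regs p <= m)%nat -> forall t, simulates m b Q s t ->
  runs w' (relocate p) t (3 * T) (fun t' => simulates m b Q s' t' /\ frame b Q t t').
Proof.
  intros H; induction H as
    [s|s r e v He|s e1 e2 a v He1 He2|s s1 s2 p q T1 T2 H1 IH1 H2 IH2
    |s s1 e p q v T He Hv H IH|s s1 e p q T He H IH
    |s s1 s2 e p v T1 T2 He Hv H1 IH1 H2 IH2|s e p He];
    cbn [cmd_regs]; intros Hle t Hst.
  - do 2 eexists; split; [constructor|split; [lia|split; auto using frame_refl]].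
  - pose proof (relocate_cost e); eapply runs_bound; [eapply runs_assign|lia].
    + eapply relocate_eval; eauto; lia.
    + destruct Hst as (Hr & Hb & Hm); split; [split; [|split]|split]; cbn [reg mem set_reg]; auto.
      * intros r' Hr'; destruct (Nat.eqb_spec (8 + r') (8 + r)), (Nat.eqb_spec r' r); auto; lia.
      * intros r' Hr'; destruct (Nat.eqb_spec r' (8 + r)); auto; lia.
  - pose proof (relocate_cost e1); pose proof (relocate_cost e2).
    pose proof (eval_fits _ _ _ _ He1) as Ha.
    eapply runs_bound; [eapply runs_write|].
    + eapply eval_op; [apply eval_reg; [apply Hst|auto]|eapply relocate_eval; eauto; lia
        |reflexivity|apply bQ_fits; auto].
    + eapply relocate_eval; eauto; lia.
    + destruct Hst as (Hr & Hb & Hm); split; [split; [|split]|split]; cbn [reg mem set_mem binop_sem]; auto.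
      * intros a' Ha'; destruct (Z.eqb_spec (b + a') (b + a)), (Z.eqb_spec a' a); auto; lia.
      * intros a' Ha'; apply small in Ha; destruct (Z.eqb_spec a' (b + a)); auto; lia.
    + cbn [cost]; lia.
  - cbn [relocate]; rewrite Nat.mul_add_distr_l; eapply runs_seq; [apply IH1; auto; lia|].
    intros t1 [Ht1 Hf1]; eapply runs_weaken; [apply IH2; auto; lia|lia|].
    intros t2 [Ht2 Hf2]; split; eauto using frame_trans.
  - destruct (IH ltac:(lia) t Hst) as (T' & t' & Hx & L & HP).
    pose proof (relocate_cost e).
    do 2 eexists; split; [eapply exec_if_true; [eapply relocate_eval; eauto; lia|eauto|exact Hx]|].
    split; [lia|auto].
  - destruct (IH ltac:(lia) t Hst) as (T' & t' & Hx & L & HP).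
    pose proof (relocate_cost e).
    do 2 eexists; split; [eapply exec_if_false; [eapply relocate_eval; eauto; lia|exact Hx]|].
    split; [lia|auto].
  - destruct (IH1 ltac:(lia) t Hst) as (T1' & t1 & Hx1 & L1 & Ht1 & Hf1).
    destruct (IH2 Hle t1 Ht1) as (T2' & t2 & Hx2 & L2 & Ht2 & Hf2).
    pose proof (relocate_cost e).
    do 2 eexists; split;
      [eapply exec_while_true; [eapply relocate_eval; eauto; lia|eauto|exact Hx1|exact Hx2]|].
    split; [lia|split; eauto using frame_trans].
  - pose proof (relocate_cost e).
    do 2 eexists; split; [eapply exec_while_false; eapply relocate_eval; eauto; lia|].
    split; [lia|split; auto using frame_refl].
Qed.

End Relocation.

Fixpoint reset (m : nat) : cmd :=
  match m with O => Skip | S m => Seq (reset m) (Assign (8 + m) (Const 0)) end.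

Lemma reset_runs w m s :
  fits w 0 ->
  runs w (reset m) s (2 * m + 1) (fun s' =>
    (forall r, (r < m)%nat -> reg s' (8 + r) = 0) /\
    (forall r, (r < 8)%nat -> reg s' r = reg s r) /\
    (forall a, mem s' a = mem s a)).
Proof.
  intros H0; induction m as [|m IH].
  - do 2 eexists; repeat split; [constructor|lia|lia].
  - eapply runs_bound; [eapply runs_seq; [exact IH|]|].
    + intros s' (Hz & Hr & Hm); eapply runs_assign; [apply eval_const; auto|].
      cbn [reg mem set_reg]; split; [|split; auto].
      * intros r L; destruct (Nat.eqb_spec (8 + r) (8 + m)); [auto|apply Hz; lia].
      * intros r L; destruct (Nat.eqb_spec r (8 + m)); [lia|auto].
    + cbn [cost]; lia.
Qed.

(** * The reduction as a program *)

Lemma eval_add w s e1 e2 a b :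
  eval w s e1 = Some a -> eval w s e2 = Some b -> fits w (a + b) ->
  eval w s (Op Add e1 e2) = Some (a + b).
Proof. intros; eapply eval_op; eauto. Qed.

Lemma eval_sub w s e1 e2 a b :
  eval w s e1 = Some a -> eval w s e2 = Some b -> fits w (a - b) ->
  eval w s (Op Sub e1 e2) = Some (a - b).
Proof. intros; eapply eval_op; eauto. Qed.

Lemma eval_mul w s e1 e2 a b :
  eval w s e1 = Some a -> eval w s e2 = Some b -> fits w (a * b) ->
  eval w s (Op Mul e1 e2) = Some (a * b).
Proof. intros; eapply eval_op; eauto. Qed.

Lemma eval_div_nat w s e1 e2 a b :
  eval w s e1 = Some (Z.of_nat a) -> eval w s e2 = Some (Z.of_nat b) ->
  eval w s (Op Div e1 e2) = Some (Z.of_nat (a / b)).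
Proof.
  intros H1 H2; eapply eval_op; eauto; [simpl; rewrite Nat2Z.inj_div; reflexivity|].
  pose proof (eval_fits _ _ _ _ H1) as Hf; unfold fits in *.
  destruct b; [simpl; lia|].
  assert (a / S b <= a)%nat by (apply Nat.Div0.div_le_upper_bound; nia); lia.
Qed.

Lemma eval_mod_nat w s e1 e2 a b :
  eval w s e1 = Some (Z.of_nat a) -> eval w s e2 = Some (Z.of_nat b) ->
  eval w s (Op Mod e1 e2) = Some (Z.of_nat (a mod b)).
Proof.
  intros H1 H2; eapply eval_op; eauto; [simpl; rewrite Nat2Z.inj_mod; reflexivity|].
  pose proof (eval_fits _ _ _ _ H1) as Hf; unfold fits in *.
  assert (a mod b <= a)%nat by apply Nat.Div0.mod_le; lia.
Qed.

Lemma eval_eq w s e v v' : eval w s e = Some v -> v = v' -> eval w s e = Some v'.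
Proof. intros -> ->; reflexivity. Qed.

Notation "a +' b" := (Op Add a b) (at level 50, left associativity).
Notation "a -' b" := (Op Sub a b) (at level 50, left associativity).
Notation "a *' b" := (Op Mul a b) (at level 40, left associativity).

(* Memory: input and output in [0 .. Q), the matrix in [Q .. Q + n^2), where [Q]
   is in [matrixE]; the i-th query owns the window of radius [Q] around
   [2Q (i + 1)].  [lengthE] bounds the number of edges of the walks that the
   matrix accounts for, and [qE] is the counter of [fill]. *)
Notation nE := (Reg 0).
Notation orderE := (Reg 1).
Notation boundE := (Reg 2).
Notation scaleE := (Reg 3).
Notation matrixE := (Reg 4).
Notation baseE := (Reg 5).
Notation lengthE := (Reg 6).
Notation qE := (Reg 7).

Definition infE : expr := scaleE -' Const 1.

Definition init_val : expr :=
  select (Op Equal (Op Div qE nE) (Op Mod qE nE)) boundE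
    (select (Read (Const 1 +' Const 2 *' qE))
       (Read (Const 2 +' Const 2 *' qE) +' boundE) infE).

Definition uE : expr := Op Div (Op Div qE (Const 2)) orderE.
Definition vE : expr := Op Mod (Op Div qE (Const 2)) orderE.
Definition loE : expr := select (Op Less uE vE) uE vE.
Definition hiE : expr := select (Op Less uE vE) vE uE.
Definition kE : expr := hiE -' (Const 2 *' nE +' Const 1).
Definition on_pathE (e : expr) : expr := Op Less e (Const 2 *' nE +' Const 1).
Definition crossE : expr := select (on_pathE hiE) (Const 0) (on_pathE loE).
Definition offE : expr := select (Op Equal loE nE) (Const 0) crossE.
(* [select] evaluates both branches, so reads that are irrelevant are redirected
   to the first entry of the matrix, which is known to be a word. *)
Definition entryE : expr :=
  select offE
    (Read (matrixE +' select offE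
       (select (Op Less loE nE) (loE *' nE +' kE) (kE *' nE +' (loE -' (nE +' Const 1))))
       (Const 0)))
    (Const 0).
Definition distE : expr := select (Op Less loE nE) (nE -' loE) (loE -' nE).

Definition build_val : expr :=
  select (Op Mod qE (Const 2))
    (select crossE (scaleE +' Const 2 *' scaleE *' distE +' entryE) (Const 0))
    (select (on_pathE hiE) (Op Equal hiE (loE +' Const 1)) crossE).

Definition iE : expr := Op Div qE nE.
Definition jE : expr := Op Mod qE nE.
Definition indexE : expr :=
  (Const 2 *' nE +' Const 4) +'
  ((iE *' (Const 3 *' nE +' Const 10) +' Const 3 *' Op Div (iE *' (iE -' Const 1)) (Const 2)) +'
   ((nE +' iE +' Const 6) +' (Const 2 *' (iE +' Const 2 +' jE) +' Const 1))).
Definition sumE : expr :=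
  Read (baseE +' indexE) -' (Const 2 *' scaleE +' Const 2 *' scaleE *' (nE -' iE +' jE +' Const 1)).

Definition extract_val : expr :=
  select (Op Less sumE infE) (sumE -' boundE) infE.

Definition cellE : expr := Read (matrixE +' Op Div qE (Const 2)).
Definition output_val : expr :=
  select (Op Mod qE (Const 2))
    (select (Op Less cellE infE) (cellE -' boundE) (Const 0)) (Op Less cellE infE).

Definition step (m : nat) (p : cmd) : cmd :=
  Seq (Assign 5 (baseE +' Const 2 *' matrixE))
  (Seq (reset m)
  (Seq (Write baseE orderE)
  (Seq (Write (baseE +' Const 2) (Const 2 *' nE))
  (Seq (fill (Const 2 *' (orderE *' orderE)) (baseE +' Const 3) build_val)
  (Seq (relocate p)
  (Seq (fill (nE *' nE) matrixE extract_val)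
       (Assign 6 (Const 2 *' lengthE)))))))).

Definition apsp_program (c e m : nat) (p : cmd) : cmd :=
  Seq (Assign 0 (Read (Const 0)))
  (Seq (Assign 1 (Const 3 *' nE +' Const 1))
  (Seq (Assign 2 (Const 2 *' nE *' power nE c))
  (Seq (Assign 3 (Const 4 *' boundE +' Const 2))
  (Seq (Assign 4 (power (Const 2 *' orderE) e))
  (Seq (Assign 5 (Const 2 *' matrixE))
  (Seq (Assign 6 (Const 1))
  (Seq (fill (nE *' nE) matrixE init_val)
  (Seq (While (Op Less lengthE nE) (step m p))
       (fill (Const 2 *' (nE *' nE)) (Const 0) output_val))))))))).

Section Program.

Context (w n : nat) (B M Q : Z).
Notation zn := (Z.of_nat n).
Notation W := (4 * B + 2).
Notation N := (3 * n + 1)%nat.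
Context (n_pos : (1 <= n)%nat) (B_nonneg : 0 <= B).
Context (M_n : zn <= M) (M_nn : zn * zn <= M) (M_B : B <= M) (M_Bn : B * zn <= M).
Context (Q_M : 1000 * M <= Q).
Context (fits_Q : forall z, - (19 * (Q * zn)) <= z <= 19 * (Q * zn) -> fits w z).

Definition env (b : Z) (s : state) : Prop :=
  reg s 0%nat = zn /\ reg s 1%nat = Z.of_nat N /\ reg s 2%nat = B /\ reg s 3%nat = W /\
  reg s 4%nat = Q /\ reg s 5%nat = b.

Definition stores (s : state) (D : nat -> nat -> Z) : Prop :=
  forall u v, (u < n)%nat -> (v < n)%nat -> mem s (Q + Z.of_nat (u * n + v)) = D u v.

Lemma Q_Qn : Q <= Q * zn.
Proof. nia. Qed.

Lemma fits_one : fits w 1.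
Proof. apply fits_Q; pose proof Q_Qn; lia. Qed.

Ltac range := apply fits_Q; pose proof Q_Qn; lia.

Ltac ev :=
  first
  [ eassumption
  | lazymatch goal with
    | |- eval _ _ (Const _) = _ => apply eval_const; range
    | |- eval _ _ (Reg _) = _ => apply eval_reg; [eassumption|range]
    | |- eval _ _ (Op Add _ _) = _ => apply eval_add; [ev|ev|range]
    | |- eval _ _ (Op Sub _ _) = _ => apply eval_sub; [ev|ev|range]
    | |- eval _ _ (Op Mul _ _) = _ => apply eval_mul; [ev|ev|range]
    | |- eval _ _ (Op Less _ _) = _ => apply eval_less; [apply fits_one|ev|ev]
    | |- eval _ _ (Op Equal _ _) = _ => apply eval_equal; [apply fits_one|ev|ev]
    | |- eval _ _ (select _ _ _) = _ => apply eval_select; [apply fits_one|ev|ev|ev]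
    end ].

Ltac ev_to := eapply eval_eq; [ev|].

Lemma div_mod_below q m : (q < m * n)%nat -> (q / n < m)%nat /\ (q mod n < n)%nat /\
  q = (q / n * n + q mod n)%nat.
Proof.
  intros H; pose proof (Nat.div_mod_eq q n).
  repeat split; [apply Nat.Div0.div_lt_upper_bound|apply Nat.mod_upper_bound|]; nia.
Qed.

Lemma eval_two s : eval w s (Const 2) = Some (Z.of_nat 2).
Proof. apply eval_const; range. Qed.

Lemma eval_init b s G q :
  env b s -> n = order G -> weights_within G (- B) B ->
  (forall u v c, (u < n)%nat -> (v < n)%nat -> (c < 2)%nat ->
     mem s (1 + Z.of_nat (2 * (u * n + v) + c)) = option_cell (weight G u v) c) ->
  reg s 7%nat = Z.of_nat q -> (q < n * n)%nat ->
  eval w s init_val = Some (first_entry B G (q / n) (q mod n)).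
Proof.
  intros (H0 & H1 & H2 & H3 & H4 & H5) HG Hb Hm H7 Hq.
  destruct (div_mod_below q n Hq) as (Hu & Hv & Hqe).
  set (u := (q / n)%nat) in *; set (v := (q mod n)%nat) in *.
  assert (Z.of_nat q < zn * zn) by lia.
  assert (Eq : eval w s qE = Some (Z.of_nat q)) by ev.
  assert (En : eval w s nE = Some zn) by ev.
  assert (Eu : eval w s (Op Div qE nE) = Some (Z.of_nat u)) by (apply eval_div_nat; auto).
  assert (Ev : eval w s (Op Mod qE nE) = Some (Z.of_nat v)) by (apply eval_mod_nat; auto).
  assert (Ef : eval w s (Read (Const 1 +' Const 2 *' qE)) =
    Some (Z.b2z (match weight G u v with Some _ => true | None => false end))).
  { eapply eval_read; [ev| |apply fits_bool, fits_one].
    replace (1 + 2 * Z.of_nat q) with (1 + Z.of_nat (2 * (u * n + v) + 0)) by lia.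
    rewrite Hm by auto; destruct (weight G u v); reflexivity. }
  set (z := match weight G u v with Some z => z | None => 0 end).
  assert (Hz : - B <= z <= B).
  { unfold z; destruct (weight G u v) as [y|] eqn:E; [|lia].
    apply (Hb u v); auto; lia. }
  assert (Ew : eval w s (Read (Const 2 +' Const 2 *' qE)) = Some z).
  { eapply eval_read; [ev| |range].
    replace (2 + 2 * Z.of_nat q) with (1 + Z.of_nat (2 * (u * n + v) + 1)) by lia.
    rewrite Hm by auto; unfold z; destruct (weight G u v); reflexivity. }
  unfold init_val, infE; ev_to; unfold first_entry, z.
  destruct (Z.eqb_spec (Z.of_nat u) (Z.of_nat v)), (Nat.eqb_spec u v); try lia.
  destruct (weight G u v); lia.
Qed.

Definition product_entries (D : nat -> nat -> Z) (i k : nat) : Z :=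
  if (i <? n)%nat then D i k else if (i =? n)%nat then 0 else D k (i - (n + 1))%nat.

Lemma eval_build b s D q :
  env b s -> stores s D ->
  (forall u v, (u < n)%nat -> (v < n)%nat -> 0 <= D u v < W) ->
  reg s 7%nat = Z.of_nat q -> (q < 2 * (N * N))%nat ->
  eval w s build_val = Some (nth q (encode_matrix N (gadget_weight n W (product_entries D))) 0).
Proof.
  intros (H0 & H1 & H2 & H3 & H4 & H5) Hs HD H7 Hq.
  pose proof (Nat.div_mod_eq q 2) as Eq2; pose proof (Nat.mod_upper_bound q 2 ltac:(lia)) as Hc.
  pose proof (Nat.div_mod_eq (q / 2) N) as EqN.
  pose proof (Nat.mod_upper_bound (q / 2) N ltac:(lia)) as Hv.
  assert (Hu : (q / 2 / N < N)%nat).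
  { apply Nat.Div0.div_lt_upper_bound; auto; lia. }
  assert (Hqz : Z.of_nat q < 100 * M) by nia.
  assert (Eq : eval w s qE = Some (Z.of_nat q)) by ev.
  assert (En : eval w s nE = Some zn) by ev.
  assert (EN : eval w s orderE = Some (Z.of_nat N)) by ev.
  assert (Eh : eval w s (Op Div qE (Const 2)) = Some (Z.of_nat (q / 2)))
    by (apply eval_div_nat; auto using eval_two).
  assert (Ec : eval w s (Op Mod qE (Const 2)) = Some (Z.b2z (q mod 2 =? 1)%nat)).
  { eapply eval_eq; [apply eval_mod_nat; [exact Eq|apply eval_two]|].
    destruct (q mod 2)%nat as [|[|]]; simpl; lia. }
  assert (Eu : eval w s uE = Some (Z.of_nat (q / 2 / N))) by (apply eval_div_nat; auto).
  assert (Ev : eval w s vE = Some (Z.of_nat (q / 2 mod N))) by (apply eval_mod_nat; auto).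
  replace (nth q _ 0) with
    (nth (2 * (q / 2 / N * N + q / 2 mod N) + q mod 2)
      (encode_matrix N (gadget_weight n W (product_entries D))) 0) by (f_equal; lia).
  rewrite nth_encode_matrix by auto.
  set (u := (q / 2 / N)%nat) in *; set (v := (q / 2 mod N)%nat) in *.
  set (c := (q mod 2)%nat) in *; clearbody u v c; clear Eq2 EqN.
  unfold gadget_weight.
  assert (El : eval w s loE = Some (Z.of_nat (Nat.min u v))).
  { unfold loE; ev_to. destruct (Z.ltb_spec (Z.of_nat u) (Z.of_nat v)); lia. }
  assert (Eg : eval w s hiE = Some (Z.of_nat (Nat.max u v))).
  { unfold hiE; ev_to. destruct (Z.ltb_spec (Z.of_nat u) (Z.of_nat v)); lia. }
  assert (Hlo : (Nat.min u v <= 3 * n)%nat) by lia.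
  assert (Hhi : (Nat.max u v <= 3 * n)%nat) by lia.
  set (lo := Nat.min u v) in *; set (hi := Nat.max u v) in *.
  clearbody lo hi; clear Eu Ev Hu Hv u v.
  assert (Ek : eval w s kE = Some (Z.of_nat hi - (2 * zn + 1))) by (unfold kE; ev).
  assert (Ep1 : eval w s (on_pathE loE) = Some (Z.b2z (lo <=? 2 * n)%nat)).
  { unfold on_pathE; ev_to; f_equal.
    destruct (Z.ltb_spec (Z.of_nat lo) (2 * zn + 1)), (Nat.leb_spec lo (2 * n)); auto; lia. }
  assert (Ep2 : eval w s (on_pathE hiE) = Some (Z.b2z (hi <=? 2 * n)%nat)).
  { unfold on_pathE; ev_to; f_equal.
    destruct (Z.ltb_spec (Z.of_nat hi) (2 * zn + 1)), (Nat.leb_spec hi (2 * n)); auto; lia. }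
  set (cross := negb (hi <=? 2 * n)%nat && (lo <=? 2 * n)%nat).
  assert (Ecr : eval w s crossE = Some (Z.b2z cross)).
  { unfold crossE; ev_to; unfold cross; destruct (hi <=? 2 * n)%nat; reflexivity. }
  set (off := negb (lo =? n)%nat && cross).
  assert (Eo : eval w s offE = Some (Z.b2z off)).
  { unfold offE; ev_to; unfold off.
    destruct (Z.eqb_spec (Z.of_nat lo) zn), (Nat.eqb_spec lo n); try lia; reflexivity. }
  set (k := (hi - (2 * n + 1))%nat).
  set (addr := if off then
      (if (lo <? n)%nat then (lo * n + k)%nat else (k * n + (lo - (n + 1)))%nat) else 0%nat).
  assert (0 <= Z.of_nat lo * zn <= 3 * (zn * zn)) by nia.
  assert (- (3 * (zn * zn)) <= (Z.of_nat hi - (2 * zn + 1)) * zn <= 3 * (zn * zn)) by nia.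
  assert (Ea : eval w s (matrixE +' select offE
       (select (Op Less loE nE) (loE *' nE +' kE) (kE *' nE +' (loE -' (nE +' Const 1))))
       (Const 0)) = Some (Q + Z.of_nat addr)).
  { eapply eval_eq; [apply eval_add; [ev|ev|]|f_equal].
    - apply fits_Q; pose proof Q_Qn; destruct off, (Z.of_nat lo <? zn); lia.
    - unfold addr, off, cross, k.
      destruct (Nat.eqb_spec lo n), (Nat.leb_spec hi (2 * n)), (Nat.leb_spec lo (2 * n)),
        (Z.ltb_spec (Z.of_nat lo) zn), (Nat.ltb_spec lo n); cbn [negb andb]; nia. }
  pose proof (Hs 0 0 n_pos n_pos)%nat as Hs0; cbn [Nat.mul Nat.add] in Hs0.
  assert (Hcell : 0 <= mem s (Q + Z.of_nat addr) < W /\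
    (off = true -> mem s (Q + Z.of_nat addr) = product_entries D lo k)).
  { unfold addr, product_entries, off, cross.
    destruct (Nat.eqb_spec lo n), (Nat.leb_spec hi (2 * n)), (Nat.leb_spec lo (2 * n)),
        (Nat.ltb_spec lo n); cbn [negb andb]; try lia;
      try (rewrite Hs0; split; [apply HD; lia|discriminate]).
    - rewrite (Hs lo k) by (unfold k; lia); split; [apply HD; unfold k; lia|auto].
    - rewrite (Hs k (lo - (n + 1))%nat) by (unfold k; lia); split; [apply HD; unfold k; lia|auto]. }
  destruct Hcell as [Hcell1 Hcell2].
  assert (Ee : eval w s entryE = Some (if off then mem s (Q + Z.of_nat addr) else 0)).
  { unfold entryE. apply eval_select; [apply fits_one|ev| |ev].
    eapply eval_read; [exact Ea|reflexivity|range]. }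
  set (e := if off then mem s (Q + Z.of_nat addr) else 0) in *.
  assert (He : 0 <= e < W) by (unfold e; destruct off; lia).
  assert (Hec : cross = true -> e = product_entries D lo k).
  { intros Hcr; unfold e; destruct off eqn:Eoff; [auto|].
    unfold off in Eoff; rewrite Hcr in Eoff; unfold product_entries.
    destruct (Nat.eqb_spec lo n); [|discriminate].
    destruct (Nat.ltb_spec lo n); [lia|reflexivity]. }
  assert (Ed : eval w s distE = Some (Z.abs (zn - Z.of_nat lo))).
  { unfold distE; ev_to; destruct (Z.ltb_spec (Z.of_nat lo) zn); lia. }
  assert (0 <= B * Z.abs (zn - Z.of_nat lo) <= 3 * (B * zn)) by nia.
  clearbody e; clear Ea Hcell1 Hcell2.
  unfold build_val; ev_to.
  unfold crossing; fold k.
  destruct (Nat.leb_spec hi (2 * n)) as [L|L].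
  - replace cross with false by (unfold cross; destruct (Nat.leb_spec hi (2 * n)); [reflexivity|lia]).
    destruct (Z.eqb_spec (Z.of_nat hi) (Z.of_nat lo + 1)), (Nat.eqb_spec hi (S lo)); try lia;
    destruct c as [|[|]]; try lia; reflexivity.
  - assert (Hcr : cross = (lo <=? 2 * n)%nat)
      by (unfold cross; destruct (Nat.leb_spec hi (2 * n)); [lia|reflexivity]).
    rewrite Hcr in *.
    destruct (lo <=? 2 * n)%nat; destruct c as [|[|]]; try lia; try reflexivity.
    cbn; rewrite Hec; auto.
Qed.

Lemma eval_extract b s q c :
  env b s -> 0 <= b <= 8 * (Q * zn) -> reg s 7%nat = Z.of_nat q -> (q < n * n)%nat ->
  mem s (b + Z.of_nat (answer_index n (q / n) (q mod n))) =
    2 * W + 2 * W * (zn - Z.of_nat (q / n) + Z.of_nat (q mod n) + 1) + c ->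
  0 <= c < 2 * W ->
  eval w s extract_val = Some (clip B c).
Proof.
  intros (H0 & H1 & H2 & H3 & H4 & H5) Hb H7 Hq Hm Hc.
  destruct (div_mod_below q n Hq) as (Hi & Hj & Hqe).
  set (i := (q / n)%nat) in *; set (j := (q mod n)%nat) in *.
  assert (Z.of_nat q < zn * zn) by lia.
  assert (Eq : eval w s qE = Some (Z.of_nat q)) by ev.
  assert (En : eval w s nE = Some zn) by ev.
  assert (Ei : eval w s iE = Some (Z.of_nat i)) by (apply eval_div_nat; auto).
  assert (Ej : eval w s jE = Some (Z.of_nat j)) by (apply eval_mod_nat; auto).
  clearbody i j.
  assert (0 <= Z.of_nat i * zn <= zn * zn) by nia.
  assert (0 <= Z.of_nat i * Z.of_nat i <= zn * zn) by nia.
  assert (Hh : (i * (i - 1) / 2 <= i * i)%nat) by (apply Nat.Div0.div_le_upper_bound; nia).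
  assert (Eh : eval w s (Op Div (iE *' (iE -' Const 1)) (Const 2)) =
    Some (Z.of_nat (i * (i - 1) / 2))).
  { apply eval_div_nat; [|apply eval_two]. ev_to. nia. }
  assert (Ex : eval w s indexE = Some (Z.of_nat (answer_index n i j))).
  { unfold indexE; ev_to; unfold answer_index, row_offset; lia. }
  assert (Hx : 0 <= Z.of_nat (answer_index n i j) <= 100 * M)
    by (unfold answer_index, row_offset; lia).
  set (V := 2 * W + 2 * W * (zn - Z.of_nat i + Z.of_nat j + 1)) in *.
  assert (0 <= B * (zn - Z.of_nat i + Z.of_nat j + 1) <= 3 * (B * zn)) by nia.
  assert (0 <= V <= 100 * M) by (unfold V; lia).
  assert (Es : eval w s sumE = Some c).
  { unfold sumE; eapply eval_eq; [apply eval_sub|].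
    - eapply eval_read; [ev|exact Hm|range].
    - ev.
    - unfold V; range.
    - unfold V; lia. }
  clearbody V.
  unfold extract_val, infE; ev_to; unfold clip.
  replace (W - 1) with (4 * B + 1) by lia; reflexivity.
Qed.

Lemma eval_output b s D q :
  env b s -> stores s D ->
  (forall u v, (u < n)%nat -> (v < n)%nat -> 0 <= D u v < W) ->
  reg s 7%nat = Z.of_nat q -> (q < 2 * (n * n))%nat ->
  eval w s output_val =
    Some (nth q (encode_matrix n (fun u v => decode B (D u v))) 0).
Proof.
  intros (H0 & H1 & H2 & H3 & H4 & H5) Hs HD H7 Hq.
  pose proof (Nat.div_mod_eq q 2) as Eq2; pose proof (Nat.mod_upper_bound q 2 ltac:(lia)) as Hc.
  destruct (div_mod_below (q / 2) n) as (Hu & Hv & Hqe); [lia|].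
  assert (Z.of_nat q < 2 * (zn * zn)) by lia.
  assert (Eq : eval w s qE = Some (Z.of_nat q)) by ev.
  assert (Eh : eval w s (Op Div qE (Const 2)) = Some (Z.of_nat (q / 2)))
    by (apply eval_div_nat; auto using eval_two).
  assert (Ec : eval w s (Op Mod qE (Const 2)) = Some (Z.b2z (q mod 2 =? 1)%nat)).
  { eapply eval_eq; [apply eval_mod_nat; [exact Eq|apply eval_two]|].
    destruct (q mod 2)%nat as [|[|]]; simpl; lia. }
  replace (nth q _ 0) with
    (nth (2 * (q / 2 / n * n + q / 2 mod n) + q mod 2)
      (encode_matrix n (fun u v => decode B (D u v))) 0) by (f_equal; lia).
  rewrite nth_encode_matrix by auto.
  specialize (Hs _ _ Hu Hv); specialize (HD _ _ Hu Hv); rewrite <- Hqe in Hs.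
  set (x := D (q / 2 / n)%nat (q / 2 mod n)%nat) in *.
  assert (Ex : eval w s cellE = Some x).
  { eapply eval_read; [ev|exact Hs|range]. }
  unfold output_val, infE; ev_to; unfold decode.
  replace (W - 1) with (4 * B + 1) by lia.
  destruct (q mod 2)%nat as [|[|]]; try lia; destruct (x <? 4 * B + 1); reflexivity.
Qed.

Definition fresh (b : Z) (s : state) : Prop := forall a, b + Q <= a -> mem s a = 0.

Definition product (D C : nat -> nat -> Z) : Prop :=
  forall u v, (u < n)%nat -> (v < n)%nat ->
    (forall k, (k < n)%nat -> C u v <= D u k + D k v) /\
    exists k, (k < n)%nat /\ C u v = D u k + D k v.

Context (w' m T : nat) (p : cmd).
Context (p_regs : (cmd_regs p <= m)%nat).
Context (w'_small : forall z, fits w' z -> - Q <= z < Q).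
Context (oracle : forall X,
  (forall i k, (i <= 2 * n)%nat -> (k < n)%nat -> 0 <= X i k < W) ->
  (forall k, (k < n)%nat -> X n k = 0) ->
  exists t s a,
    exec w' p (initial (encode TwoFRP (StGraph (gadget n W X) 0 (2 * n)))) t s /\
    (t <= T)%nat /\ holds_output s (encode_answer a) /\
    answer_correct (gadget n W X) 0 (2 * n) a).

Lemma product_entries_range D :
  (forall u v, (u < n)%nat -> (v < n)%nat -> 0 <= D u v < W) ->
  forall i k, (i <= 2 * n)%nat -> (k < n)%nat -> 0 <= product_entries D i k < W.
Proof.
  intros HD i k Hi Hk; unfold product_entries.
  destruct (Nat.ltb_spec i n); [apply HD; auto|].
  destruct (Nat.eqb_spec i n); [lia|apply HD; lia].
Qed.

Lemma product_entries_mid D k : product_entries D n k = 0.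
Proof. unfold product_entries; rewrite Nat.ltb_irrefl, Nat.eqb_refl; reflexivity. Qed.

Lemma env_transfer b s s' :
  (forall r, (r < 6)%nat -> reg s' r = reg s r) -> env b s -> env b s'.
Proof.
  intros H (H0 & H1 & H2 & H3 & H4 & H5); repeat split; rewrite H by lia; assumption.
Qed.

Definition step_cost : nat :=
  (100 + 2 * m + (2 * (N * N) + 1) * (50 + cost build_val) + 3 * T +
   (n * n + 1) * (50 + cost extract_val))%nat.

Lemma step_runs b s D R :
  env b s -> stores s D -> (forall u v, (u < n)%nat -> (v < n)%nat -> 0 <= D u v < W) ->
  fresh b s -> 2 * Q <= b -> b + 2 * Q <= 6 * (Q * zn) ->
  reg s 6%nat = Z.of_nat R -> (R <= 2 * n)%nat ->
  runs w (step m p) s step_cost (fun s' =>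
    env (b + 2 * Q) s' /\ reg s' 6%nat = Z.of_nat (2 * R) /\ fresh (b + 2 * Q) s' /\
    exists C, product D C /\ stores s' (fun u v => clip B (C u v))).
Proof.
  intros Henv Hst HD Hfr Hb1 Hb2 H6 HR.
  pose proof Q_Qn.
  set (b' := b + 2 * Q) in *.
  assert (He1 : env b' (set_reg s 5 b')).
  { destruct Henv as (H0 & H1 & H2 & H3 & H4 & H5); repeat split; assumption. }
  set (X := product_entries D).
  set (x := StGraph (gadget n W X) 0 (2 * n)).
  assert (HX : forall i k, (i <= 2 * n)%nat -> (k < n)%nat -> 0 <= X i k < W)
    by (apply product_entries_range; auto).
  assert (HX0 : forall k, (k < n)%nat -> X n k = 0) by (intros; apply product_entries_mid).
  destruct (oracle X HX HX0) as (t & sf & a & Hex & Ht & Hout & Ha); fold x in Hex.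
  assert (HNz : 4 <= Z.of_nat N <= 4 * M /\ Z.of_nat N * Z.of_nat N <= 16 * M) by nia.
  assert (HN2 : Z.of_nat (2 * (N * N)) <= 32 * M) by lia.
  assert (Hn2 : Z.of_nat (n * n) <= M) by lia.
  eapply runs_bound.
  { unfold step. eapply runs_assign_seq.
    { destruct Henv as (H0 & H1 & H2 & H3 & H4 & H5). ev. }
    fold b'. eapply runs_seq; [apply reset_runs; range|].
    intros s1 (Hz1 & Hr1 & Hm1).
    apply (env_transfer _ _ s1) in He1; [|intros; apply Hr1; lia].
    cbn [reg set_reg mem] in Hm1.
    destruct He1 as (H0 & H1 & H2 & H3 & H4 & H5).
    eapply runs_write_seq; [ev|ev|].
    eapply runs_write_seq; [ev|ev|].
    set (s3 := set_mem (set_mem s1 b' (Z.of_nat N)) (b' + 2) (2 * zn)).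
    assert (He3 : env b' s3) by (repeat split; assumption).
    assert (Hm3 : forall c, c <> b' -> c <> b' + 2 -> mem s3 c = mem s c).
    { intros c Hc1 Hc2; cbn [mem set_mem s3].
      destruct (Z.eqb_spec c (b' + 2)), (Z.eqb_spec c b'); try contradiction; auto. }
    eapply runs_seq.
    { apply (fill_runs _ _ _ _ _ (2 * (N * N)) (b' + 3)
        (fun q => nth q (encode_matrix N (gadget_weight n W X)) 0)).
      - apply fits_one.
      - range.
      - range.
      - intros q s' Hq Hs'.
        assert (He : env b' s') by (apply (env_transfer b' s3); [intros; apply Hs'; lia|exact He3]).
        pose proof He as (H0' & H1' & H2' & H3' & H4' & H5').
        split; [|split].
        + ev_to; lia.
        + ev.
        + intros Hq'; apply (eval_build b'); auto; [|apply Hs'].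
          intros u v Hu Hv; rewrite <- (Hst u v Hu Hv).
          assert (Z.of_nat (u * n + v) < Z.of_nat (n * n)) by nia.
          destruct Hs' as (_ & _ & _ & Ho); rewrite Ho, Hm3; auto; lia. }
    intros s4 (Hr4 & _ & Hi4 & Ho4).
    assert (He4 : env b' s4) by (apply (env_transfer b' s3); [intros; apply Hr4; lia|exact He3]).
    assert (Hsim : simulates m b' Q (initial (encode TwoFRP x)) s4).
    { split; [|split].
      - intros r Hr; rewrite Hr4 by lia; apply Hz1; auto.
      - apply He4.
      - intros c Hc; cbn [initial mem encode TwoFRP x graph_of source target gadget order].
        destruct (Z.ltb_spec c 0).
        { rewrite Ho4, Hm3 by lia; apply Hfr; lia. }
        destruct (Z.to_nat c) as [|[|[|q]]] eqn:Ec.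
        + replace c with 0 by lia; rewrite Ho4 by lia; unfold s3; cbn [mem set_mem].
          destruct (Z.eqb_spec (b' + 0) (b' + 2)), (Z.eqb_spec (b' + 0) b'); try lia; reflexivity.
        + replace c with 1 by lia; rewrite Ho4, Hm3 by lia; apply Hfr; lia.
        + replace c with 2 by lia; rewrite Ho4 by lia; unfold s3; cbn [mem set_mem].
          rewrite Z.eqb_refl; cbn [nth]; lia.
        + cbn [nth]; replace (b' + c) with (b' + 3 + Z.of_nat q) by lia.
          destruct (Nat.lt_ge_cases q (2 * (N * N))).
          * rewrite Hi4 by auto; reflexivity.
          * rewrite nth_overflow by (rewrite length_encode_matrix; auto).
            rewrite Ho4, Hm3 by lia; apply Hfr; lia. }
    eapply runs_seq.
    { apply (relocate_exec w' w m b' Q w'_small) with (s := initial (encode TwoFRP x)) (T := t) (s' := sf);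
        auto; [range|intros; range|intros; range]. }
    intros s5 [Hs5 [Hr5 Ho5]].
    assert (He5 : env b' s5) by (apply (env_transfer b' s4); [intros; apply Hr5; lia|exact He4]).
    set (V := fun i j => 2 * W + 2 * W * (zn - Z.of_nat i + Z.of_nat j + 1)).
    set (C := fun i j => nth (answer_index n i j) (encode_answer a) 0 - V i j).
    assert (HC : product D C).
    { intros u v Hu Hv.
      destruct (answer_value n W X n_pos ltac:(lia) HX HX0 a u v Ha Hu Hv)
        as (c & _ & Hc & Hmin & k & Hk & Hck).
      assert (HXu : forall k, X u k = D u k).
      { intros; unfold X, product_entries; destruct (Nat.ltb_spec u n); [reflexivity|lia]. }
      assert (HXv : forall k, X (n + 1 + v)%nat k = D k v).
      { intros; unfold X, product_entries; destruct (Nat.ltb_spec (n + 1 + v) n); [lia|].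
        destruct (Nat.eqb_spec (n + 1 + v) n); [lia|f_equal; lia]. }
      unfold C, V; rewrite Hc; split.
      - intros k' Hk'; specialize (Hmin k' Hk'); rewrite HXu, HXv in Hmin; lia.
      - exists k; split; auto; rewrite HXu, HXv in Hck; lia. }
    eapply runs_seq.
    { apply (fill_runs _ _ _ _ _ (n * n) Q (fun q => clip B (C (q / n) (q mod n))%nat)).
      - apply fits_one.
      - range.
      - range.
      - intros q s' Hq Hs'.
        assert (He : env b' s') by (apply (env_transfer b' s5); [intros; apply Hs'; lia|exact He5]).
        pose proof He as (H0' & H1' & H2' & H3' & H4' & H5').
        split; [|split].
        + ev_to; lia.
        + ev.
        + intros Hq'; destruct (div_mod_below q n Hq') as (Hu & Hv & Hqe).
          destruct (answer_value n W X n_pos ltac:(lia) HX HX0 a _ _ Ha Hu Hv)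
            as (_ & Hlt & _).
          assert (Hix : Z.of_nat (answer_index n (q / n) (q mod n)) <= 100 * M).
          { unfold answer_index, row_offset; set (i := (q / n)%nat) in *.
            assert (i * (i - 1) / 2 <= i * i)%nat by (apply Nat.Div0.div_le_upper_bound; nia).
            nia. }
          apply (eval_extract b' s' q); auto; [lia|exact (proj1 (proj2 Hs'))| |].
          * destruct Hs' as (_ & _ & _ & Ho); rewrite Ho by lia.
            destruct Hs5 as (_ & _ & Hms); rewrite Hms by lia.
            rewrite Hout by auto. unfold C, V; lia.
          * destruct (HC _ _ Hu Hv) as [_ (k & Hk & ->)].
            pose proof (HD _ _ Hu Hk); pose proof (HD _ _ Hk Hv); lia. }
    intros s6 (Hr6 & _ & Hi6 & Ho6).
    assert (He6 : env b' s6) by (apply (env_transfer b' s5); [intros; apply Hr6; lia|exact He5]).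
    assert (H66 : reg s6 6%nat = Z.of_nat R).
    { rewrite Hr6, Hr5, Hr4 by lia; unfold s3; cbn [reg set_mem]; rewrite Hr1 by lia; exact H6. }
    eapply runs_assign; [ev|].
    split; [|split; [|split]].
    - destruct He6 as (H0' & H1' & H2' & H3' & H4' & H5'); repeat split; assumption.
    - cbn [reg set_reg Nat.eqb]; lia.
    - intros c Hc; cbn [mem set_reg].
      rewrite Ho6, Ho5, Ho4, Hm3 by lia; apply Hfr; lia.
    - exists C; split; [exact HC|].
      intros u v Hu Hv; cbn [mem set_reg]; rewrite Hi6 by nia.
      rewrite Nat.div_add_l, Nat.div_small, Nat.add_0_r by lia.
      rewrite Nat.add_comm, Nat.Div0.mod_add, Nat.mod_small by lia; reflexivity. }
  unfold step_cost; cbn [cost]; nia.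
Qed.

Context (G : graph) (c e : nat).
Context (G_order : order G = n) (G_loopless : loopless G) (G_cycle : no_negative_cycle G).
Context (G_weights : weights_within G (- zn ^ Z.of_nat c) (zn ^ Z.of_nat c)).
Context (B_def : B = 2 * zn * zn ^ Z.of_nat c) (Q_def : Q = (2 * Z.of_nat N) ^ Z.of_nat e).

Definition loop_cost : nat :=
  (Nat.log2_up n * (4 + step_cost) + 4)%nat.

Definition apsp_cost : nat :=
  (200 + cost (power nE c) + cost (power (Const 2 *' orderE) e) +
   (n * n + 1) * (50 + cost init_val) + loop_cost +
   (2 * (n * n) + 1) * (50 + cost output_val))%nat.

Definition loop_invariant (j : nat) (s : state) : Prop :=
  let i := (Nat.log2_up n - j)%nat in
  (j <= Nat.log2_up n)%nat /\ env (2 * Q * (1 + Z.of_nat i)) s /\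
  reg s 6%nat = Z.of_nat (2 ^ i) /\ fresh (2 * Q * (1 + Z.of_nat i)) s /\
  exists D, stores s D /\ represents G B (2 ^ i) D.

Lemma represents_entries R D :
  represents G B R D -> forall u v, (u < n)%nat -> (v < n)%nat -> 0 <= D u v < W.
Proof. rewrite <- G_order; intros; eapply represents_range; eauto. Qed.

Lemma pow_lt_log2_up i : (i < Nat.log2_up n)%nat -> (2 ^ i < n)%nat.
Proof.
  intros Hi. assert (1 < n)%nat.
  { destruct (Nat.eq_dec n 1) as [E|]; [rewrite E, Nat.log2_up_1 in Hi|]; lia. }
  destruct (Nat.log2_up_spec n ltac:(lia)) as [Hl _].
  eapply Nat.le_lt_trans; [apply Nat.pow_le_mono_r|exact Hl]; lia.
Qed.

Lemma loop_runs s :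
  loop_invariant (Nat.log2_up n) s ->
  runs w (While (Op Less lengthE nE) (step m p)) s loop_cost (loop_invariant 0).
Proof.
  intros H; eapply runs_bound.
  { eapply runs_while with (I := loop_invariant); [| |exact H].
    - intros j s' (Hj & He & H6 & Hf & D & Hs & Hr).
      set (i := (Nat.log2_up n - S j)%nat) in *.
      replace (Nat.log2_up n - j)%nat with (S i) by lia.
      pose proof (pow_lt_log2_up i ltac:(lia)) as Hp.
      pose proof (Nat.log2_up_le_lin n ltac:(lia)) as Hl.
      pose proof Q_Qn.
      split.
      + pose proof He as (Hn & _). ev_to.
        rewrite (proj2 (Z.ltb_lt _ _)); [reflexivity|lia].
      + assert (0 <= Q * Z.of_nat i) by nia.
        assert (Q * (Z.of_nat i + 1) <= Q * zn) by (apply Z.mul_le_mono_nonneg_l; lia).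
        eapply runs_weaken.
        * apply (step_runs _ _ D (2 ^ i)%nat He Hs); auto; try lia.
          eapply represents_entries; eauto.
        * apply Nat.le_refl.
        * intros s2 (He2 & H62 & Hf2 & C & HC & Hs2).
          unfold loop_invariant; replace (Nat.log2_up n - j)%nat with (S i) by lia.
          replace (2 * Q * (1 + Z.of_nat (S i))) with (2 * Q * (1 + Z.of_nat i) + 2 * Q) by lia.
          split; [lia|split; [exact He2|split; [exact H62|split; [exact Hf2|]]]].
          exists (fun u v => clip B (C u v)); split; [exact Hs2|].
          apply (represents_square G B (zn ^ Z.of_nat c) (2 ^ i) D); auto.
          -- rewrite B_def. apply Z.mul_le_mono_nonneg_r; [apply Z.pow_nonneg|]; lia.
          -- apply Z.pow_nonneg; lia.
          -- rewrite G_order; exact HC.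
    - intros s' (Hj & (Hn & _) & H6 & _).
      rewrite Nat.sub_0_r in H6.
      assert (n <= 2 ^ Nat.log2_up n)%nat.
      { destruct (Nat.eq_dec n 1) as [E|]; [rewrite E; simpl; lia|].
        apply Nat.log2_up_spec; lia. }
      assert (2 ^ Nat.log2_up n <= 2 * n)%nat.
      { destruct (Nat.eq_dec n 1) as [E|]; [rewrite E; simpl; lia|].
        destruct (Nat.log2_up_spec n ltac:(lia)) as [Hl _].
        pose proof (Nat.log2_up_pos n ltac:(lia)).
        replace (Nat.log2_up n) with (S (Nat.pred (Nat.log2_up n))) by lia.
        rewrite Nat.pow_succ_r'; lia. }
      pose proof Q_Qn.
      ev_to; rewrite (proj2 (Z.ltb_ge _ _)); [reflexivity|lia]. }
  unfold loop_cost; cbn [cost]; lia.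
Qed.

Lemma apsp_program_runs :
  runs w (apsp_program c e m p) (initial (encode APSP G)) apsp_cost (fun s =>
    exists D, (forall u v, (u < n)%nat -> (v < n)%nat -> is_distance G u v (D u v)) /\
      holds_output s (encode_matrix n D)).
Proof.
  pose proof Q_Qn.
  assert (Hc : 1 <= zn ^ Z.of_nat c) by (apply (Z.pow_le_mono_r zn 0); lia).
  assert (Hcf : fits w (zn ^ Z.of_nat c)) by (apply fits_Q; nia).
  assert (Hn2 : Z.of_nat (n * n) <= M) by lia.
  eapply runs_bound.
  { unfold apsp_program.
    eapply runs_assign_seq.
    { apply eval_read with (a := 0) (v := zn); [ev| |range]. cbn; rewrite G_order; reflexivity. }
    eapply runs_assign_seq.
    { eapply eval_add; [eapply eval_mul; [ev|apply eval_reg with (v := zn); [reflexivity|range]|range]|ev|range]. }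
    eapply runs_assign_seq.
    { eapply eval_mul.
      - eapply eval_mul; [ev|apply eval_reg with (v := zn); [reflexivity|range]|range].
      - apply eval_power with (a := zn); [apply eval_reg with (v := zn); [reflexivity|range]|lia|exact Hcf].
      - rewrite <- B_def; range. }
    rewrite <- B_def.
    eapply runs_assign_seq.
    { eapply eval_add; [eapply eval_mul; [ev|apply eval_reg with (v := B); [reflexivity|range]|range]|ev|range]. }
    eapply runs_assign_seq.
    { apply eval_power with (a := 2 * (3 * zn + 1)).
      - eapply eval_mul; [ev|apply eval_reg with (v := (3 * zn + 1)); [reflexivity|range]|range].
      - lia.
      - replace ((2 * (3 * zn + 1)) ^ Z.of_nat e) with Q by (rewrite Q_def; f_equal; lia); range. }
    replace ((2 * (3 * zn + 1)) ^ Z.of_nat e) with Q by (rewrite Q_def; f_equal; lia).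
    eapply runs_assign_seq.
    { eapply eval_mul; [ev|apply eval_reg with (v := Q); [reflexivity|range]|range]. }
    eapply runs_assign_seq; [ev|].
    match goal with |- runs _ _ ?st _ _ => set (s0 := st) end.
    assert (He0 : env (2 * Q) s0) by (unfold s0; repeat split; cbn [reg set_reg Nat.eqb]; lia).
    assert (H60 : reg s0 6%nat = 1) by reflexivity.
    assert (Hm0 : forall a, mem s0 a =
      if a <? 0 then 0 else nth (Z.to_nat a) (zn :: encode_matrix n (weight G)) 0)
      by (intros; cbn; rewrite G_order; reflexivity).
    clearbody s0.
    eapply runs_seq.
    { apply (fill_runs _ _ _ _ _ (n * n) Q (fun q => first_entry B G (q / n) (q mod n))).
      - apply fits_one.
      - range.
      - range.
      - intros q s' Hq Hs'.
        assert (He : env (2 * Q) s')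
          by (apply (env_transfer (2 * Q) s0); [intros; apply Hs'; lia|exact He0]).
        pose proof He as (H0' & H1' & H2' & H3' & H4' & H5').
        split; [|split].
        + ev_to; lia.
        + ev.
        + intros Hq'; apply (eval_init (2 * Q)); auto.
          * intros u v z Hu Hv Hz; specialize (G_weights u v z Hu Hv Hz). nia.
          * intros u v b Hu Hv Hb.
            assert (Hlt : Z.of_nat (2 * (u * n + v) + b) < Z.of_nat (2 * (n * n))) by nia.
            destruct Hs' as (_ & _ & _ & Ho); rewrite Ho, Hm0 by lia.
            destruct (Z.ltb_spec (1 + Z.of_nat (2 * (u * n + v) + b)) 0); [lia|].
            replace (Z.to_nat (1 + Z.of_nat (2 * (u * n + v) + b)))
              with (S (2 * (u * n + v) + b)) by lia.
            cbn [nth]; apply nth_encode_matrix; auto.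
          * apply Hs'. }
    intros s1 (Hr1 & _ & Hi1 & Ho1).
    eapply runs_seq.
    { apply loop_runs. unfold loop_invariant; rewrite Nat.sub_diag.
      replace (2 * Q * (1 + Z.of_nat 0)) with (2 * Q) by lia.
      split; [lia|split; [|split; [|split]]].
      - apply (env_transfer (2 * Q) s0); [intros; apply Hr1; lia|exact He0].
      - rewrite Hr1 by lia; exact H60.
      - intros a Ha; rewrite Ho1, Hm0 by lia.
        destruct (Z.ltb_spec a 0); [reflexivity|].
        apply nth_overflow; cbn [length]; rewrite length_encode_matrix; lia.
      - exists (first_entry B G); split.
        + intros u v Hu Hv; rewrite Hi1 by nia.
          rewrite Nat.div_add_l, Nat.div_small, Nat.add_0_r by lia.
          rewrite Nat.add_comm, Nat.Div0.mod_add, Nat.mod_small by lia; reflexivity.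
        + apply represents_init; auto.
          intros u v z Hu Hv Hz; specialize (G_weights u v z Hu Hv Hz). nia. }
    intros s2 (_ & He2 & _ & _ & D & Hs2 & HD).
    rewrite Nat.sub_0_r in HD.
    pose proof (represents_entries _ _ HD) as HDr.
    eapply runs_weaken; [|apply Nat.le_refl|].
    { apply (fill_runs _ _ _ _ _ (2 * (n * n)) 0
        (fun q => nth q (encode_matrix n (fun u v => decode B (D u v))) 0)).
      - apply fits_one.
      - range.
      - range.
      - intros q s' Hq Hs'.
        match type of He2 with env ?b _ => assert (He : env b s')
          by (apply (env_transfer b s2); [intros; apply Hs'; lia|exact He2]);
          pose proof (fun D => eval_output b s' D q He) as Hev end.
        pose proof He as (H0' & H1' & H2' & H3' & H4' & H5').
        split; [|split].
        + ev_to; lia.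
        + ev.
        + intros Hq'; apply Hev; auto; [|apply Hs'].
          intros u v Hu Hv; rewrite <- (Hs2 u v Hu Hv).
          destruct Hs' as (_ & _ & _ & Ho); rewrite Ho; auto; lia. }
    intros s3 (_ & _ & Hi3 & _).
    exists (fun u v => decode B (D u v)); split.
    - intros u v Hu Hv.
      apply (represents_distance G B (zn ^ Z.of_nat c) (2 ^ Nat.log2_up n)); auto; try lia.

      rewrite G_order; destruct (Nat.eq_dec n 1) as [E|]; [lia|].
      pose proof (Nat.log2_up_spec n ltac:(lia)); lia.
    - intros i Hi; rewrite length_encode_matrix in Hi; apply (Hi3 i Hi). }
  unfold apsp_cost; cbn [cost].
  generalize (cost init_val), (cost output_val), (cost (power nE c)),
    (cost (power (Const 2 *' orderE) e)), loop_cost; nia.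
Qed.

End Program.

(** * Word length and running time *)

Definition entry_bound (c n : nat) : Z := 2 * Z.of_nat n * Z.of_nat n ^ Z.of_nat c.

Lemma pow_one_le a k : 1 <= a -> 1 <= a ^ Z.of_nat k.
Proof. intros; apply (Z.pow_le_mono_r a 0); lia. Qed.

Lemma gadget_weights_polynomial c n :
  (1 <= n)%nat ->
  2 * (4 * entry_bound c n + 2) * (1 + Z.of_nat n) <= Z.of_nat ((3 * n + 1) ^ (c + 5)).
Proof.
  intros Hn; rewrite Nat2Z.inj_pow, (Nat2Z.inj_add c 5), Z.pow_add_r by lia.
  unfold entry_bound.
  set (z := Z.of_nat n) in *; assert (1 <= z) by lia.
  set (y := Z.of_nat (3 * n + 1)); assert (Hy : y = 3 * z + 1) by lia.
  pose proof (pow_one_le z c ltac:(lia)).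
  assert (z ^ Z.of_nat c <= y ^ Z.of_nat c) by (apply Z.pow_le_mono_l; lia).
  set (p := z ^ Z.of_nat c) in *; set (r := y ^ Z.of_nat c) in *.
  change (y ^ Z.of_nat 5) with (y * (y * (y * (y * (y * 1))))).
  assert (2 * (4 * (2 * z * p) + 2) * (1 + z) <= p * (40 * (z * z))) by nia.
  assert (40 * (z * z) <= y * (y * (y * (y * (y * 1))))).
  { assert (9 * (z * z) <= y * y) by nia. assert (16 <= y * y) by nia.
    assert (64 <= y * (y * y)) by nia. nia. }
  nia.
Qed.

Lemma gadget_valid c n W X :
  (1 <= n)%nat -> W = 4 * entry_bound c n + 2 ->
  (forall i k, (i <= 2 * n)%nat -> (k < n)%nat -> 0 <= X i k < W) ->
  valid TwoFRP (c + 5) (StGraph (gadget n W X) 0 (2 * n)).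
Proof.
  intros Hn HW HX; cbn [valid TwoFRP graph_of source target gadget order].
  assert (0 <= entry_bound c n).
  { unfold entry_bound; pose proof (pow_one_le (Z.of_nat n) c ltac:(lia)); nia. }
  split; [lia|split; [lia|split; [|split]]].
  - intros u _; cbn [weight]; destruct (gadget_weight n W X u u) eqn:E; auto.
    apply gadget_weight_cases in E as [(? & ? & ? & ?)|[(? & k & ? & ?)|(? & k & ? & ?)]]; lia.
  - intros u v _ _; apply gadget_weight_sym.
  - intros u v z Hu Hv Hz; cbn [weight order gadget] in *.
    pose proof (gadget_weight_range n W X Hn ltac:(lia) HX u v z Hu Hv Hz).
    pose proof (gadget_weights_polynomial c n Hn); subst W; lia.
Qed.

(* [k] makes room for the addresses of the 2FRP program, and [c + 8] for the
   input, the output and the matrix. *)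
Definition address_exponent (k c : nat) : nat := (k + c + 8)%nat.
Definition word_factor (k c : nat) : nat := (4 * (address_exponent k c + 4))%nat.
Definition address_space (k c n : nat) : Z :=
  (2 * Z.of_nat (3 * n + 1)) ^ Z.of_nat (address_exponent k c).

Lemma address_space_words k c n z :
  fits (k * (Nat.log2 (3 * n + 1) + 1)) z -> - address_space k c n <= z < address_space k c n.
Proof.
  set (w := (k * (Nat.log2 (3 * n + 1) + 1))%nat); unfold fits.
  enough (2 ^ (Z.of_nat w - 1) <= address_space k c n) by lia.
  transitivity (2 ^ Z.of_nat w); [apply Z.pow_le_mono_r; lia|].
  assert (Hl : 2 ^ Z.of_nat (Nat.log2 (3 * n + 1) + 1) <= 2 * Z.of_nat (3 * n + 1)).
  { destruct (Nat.log2_spec (3 * n + 1) ltac:(lia)) as [Hl _].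
    rewrite (Nat2Z.inj_add _ 1), Z.pow_add_r by lia.
    apply inj_le in Hl; rewrite Nat2Z.inj_pow in Hl; change (Z.of_nat 2) with 2 in Hl. lia. }
  unfold w; rewrite Nat.mul_comm, Nat2Z.inj_mul, Z.pow_mul_r by lia.
  transitivity ((2 * Z.of_nat (3 * n + 1)) ^ Z.of_nat k).
  - apply Z.pow_le_mono_l; split; [apply Z.pow_nonneg; lia|exact Hl].
  - unfold address_space, address_exponent; apply Z.pow_le_mono_r; lia.
Qed.

Lemma address_space_large k c n :
  (1 <= n)%nat ->
  1000 * ((entry_bound c n + 1) * Z.of_nat n * Z.of_nat n) <= address_space k c n.
Proof.
  intros Hn; unfold address_space, address_exponent.
  set (a := 2 * Z.of_nat (3 * n + 1)).
  transitivity (a ^ Z.of_nat (c + 8)); [|apply Z.pow_le_mono_r; lia].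
  rewrite (Nat2Z.inj_add c 8), Z.pow_add_r by lia.
  unfold entry_bound.
  pose proof (pow_one_le (Z.of_nat n) c ltac:(lia)).
  assert (Z.of_nat n ^ Z.of_nat c <= a ^ Z.of_nat c) by (apply Z.pow_le_mono_l; lia).
  assert (Ha : a = 6 * Z.of_nat n + 2) by lia.
  set (z := Z.of_nat n) in *; assert (1 <= z) by lia; clearbody a z.
  set (p := z ^ Z.of_nat c) in *; set (r := a ^ Z.of_nat c) in *.
  change (Z.of_nat 8) with (4 + 4); rewrite Z.pow_add_r by lia.
  change (a ^ 4) with (a * (a * (a * (a * 1)))).
  assert ((2 * z * p + 1) * z * z <= p * (3 * (z * z * z))).
  { assert (2 * z * p + 1 <= 3 * z * p) by nia. nia. }
  assert (64 <= a * a) by nia. assert (36 * (z * z) <= a * a) by nia.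
  assert (4096 <= a * (a * (a * (a * 1)))) by nia.
  assert (3 * (z * z * z) <= a * (a * (a * (a * 1)))).
  { assert (z * z * z <= z * z * (z * z)) by nia. nia. }
  set (b := a * (a * (a * (a * 1)))) in *; clearbody b.
  assert (p * (3 * (z * z * z)) <= r * b) by (apply Z.mul_le_mono_nonneg; nia).
  assert (0 <= r * b) by nia.
  nia.
Qed.

Lemma word_large k c n z :
  (1 <= n)%nat ->
  - (19 * (address_space k c n * Z.of_nat n)) <= z <= 19 * (address_space k c n * Z.of_nat n) ->
  fits (word_factor k c * (Nat.log2 n + 1)) z.
Proof.
  intros Hn; unfold fits, word_factor, address_space.
  set (e := address_exponent k c); set (a := 2 * Z.of_nat (3 * n + 1)).
  set (w := (4 * (e + 4) * (Nat.log2 n + 1))%nat).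
  enough (19 * (a ^ Z.of_nat e * Z.of_nat n) < 2 ^ (Z.of_nat w - 1)) by lia.
  assert (Hw : 2 ^ Z.of_nat w = 2 * 2 ^ (Z.of_nat w - 1)).
  { rewrite <- Z.pow_succ_r by lia; f_equal; lia. }
  set (L := 2 ^ Z.of_nat (Nat.log2 n + 1)).
  assert (HL : Z.of_nat n < L /\ 2 <= L).
  { destruct (Nat.log2_spec n ltac:(lia)) as [_ Hl]; split.
    - apply inj_lt in Hl; rewrite Nat2Z.inj_pow in Hl; unfold L.
      rewrite Nat.add_1_r; exact Hl.
    - apply (Z.pow_le_mono_r 2 1); lia. }
  assert (HaL : a <= L ^ 4).
  { change (L ^ 4) with (L * (L * (L * (L * 1)))).
    assert (8 <= L * (L * L)) by nia. unfold a; nia. }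
  assert (Hpow : a ^ Z.of_nat (e + 4) <= 2 ^ Z.of_nat w).
  { replace (Z.of_nat w) with (Z.of_nat (Nat.log2 n + 1) * (4 * Z.of_nat (e + 4))) by lia.
    rewrite Z.pow_mul_r by lia; fold L; rewrite (Z.pow_mul_r L 4) by lia.
    apply Z.pow_le_mono_l; unfold a in *; lia. }
  rewrite (Nat2Z.inj_add e 4), Z.pow_add_r in Hpow by lia.
  change (a ^ Z.of_nat 4) with (a * (a * (a * (a * 1)))) in Hpow.
  assert (Ha : 8 <= a /\ Z.of_nat n <= a) by lia.
  assert (1 <= a ^ Z.of_nat e) by (apply pow_one_le; lia).
  assert (64 <= a * a) by nia.
  assert (64 * Z.of_nat n < a * (a * (a * (a * 1)))) by nia.
  nia.
Qed.

Lemma apsp_cost_bound m c e :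
  exists K, forall n T, (1 <= n)%nat ->
    (apsp_cost n m T c e <= (Nat.log2 n + 2) * (K * (n * n) + 3 * T))%nat.
Proof.
  set (K := (204 + cost (power nE c) + cost (power (Const 2 *' orderE) e) + 2 * m +
    2 * (50 + cost init_val) + 3 * (50 + cost output_val) + 33 * (50 + cost build_val) +
    2 * (50 + cost extract_val))%nat).
  exists K; intros n T Hn; unfold apsp_cost, loop_cost, step_cost.
  pose proof (Nat.le_log2_up_succ_log2 n) as Ht.
  assert (HK1 : (104 + 2 * m + 33 * (50 + cost build_val) + 2 * (50 + cost extract_val) <= K)%nat)
    by (unfold K; lia).
  assert (HK2 : (204 + cost (power nE c) + cost (power (Const 2 *' orderE) e) +
    2 * (50 + cost init_val) + 3 * (50 + cost output_val) <= K)%nat) by (unfold K; lia).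
  revert HK1 HK2; clearbody K; generalize dependent (Nat.log2_up n); intros t Ht.
  generalize (50 + cost init_val)%nat (50 + cost output_val)%nat (50 + cost build_val)%nat
    (50 + cost extract_val)%nat (cost (power nE c)) (cost (power (Const 2 *' orderE) e)).
  intros i o b x p q HK1 HK2.
  assert (H1 : (1 <= n * n)%nat) by nia.
  assert (H2 : (2 * ((3 * n + 1) * (3 * n + 1)) + 1 <= 33 * (n * n))%nat) by nia.
  set (y := (n * n)%nat) in *.
  set (N := (2 * ((3 * n + 1) * (3 * n + 1)) + 1)%nat) in *.
  clearbody y N.
  assert (Hy : forall z, (z <= y * z)%nat) by (intros; nia).
  assert (HN : (N * b <= 33 * (y * b))%nat)
    by (rewrite Nat.mul_assoc; apply Nat.mul_le_mono_r; exact H2).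
  assert (Hs : (4 + (100 + 2 * m + N * b + 3 * T + (y + 1) * x)
    <= y * (104 + 2 * m + 33 * b + 2 * x) + 3 * T)%nat).
  { pose proof (Hy x); pose proof (Hy m); lia. }
  assert (Hr : (204 + p + q + (y + 1) * i + (2 * y + 1) * o <=
    y * (204 + p + q + 2 * i + 3 * o))%nat).
  { pose proof (Hy i); pose proof (Hy o); pose proof (Hy p); pose proof (Hy q); lia. }
  set (u := (4 + (100 + 2 * m + N * b + 3 * T + (y + 1) * x))%nat) in *.
  set (l := Nat.log2 n) in *.
  assert (Hl : (t * u <= (l + 1) * (y * (104 + 2 * m + 33 * b + 2 * x) + 3 * T))%nat)
    by (apply Nat.mul_le_mono; lia).
  assert (Hk : (y * (104 + 2 * m + 33 * b + 2 * x) <= K * y)%nat)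
    by (rewrite Nat.mul_comm; apply Nat.mul_le_mono_r; exact HK1).
  assert (Hk' : (y * (204 + p + q + 2 * i + 3 * o) <= K * y)%nat)
    by (rewrite Nat.mul_comm; apply Nat.mul_le_mono_r; exact HK2).
  assert (Hl' : (t * u <= (l + 1) * (K * y + 3 * T))%nat)
    by (eapply Nat.le_trans; [exact Hl|apply Nat.mul_le_mono_l; lia]).
  lia.
Qed.

Open Scope R_scope.

Lemma Rpower_ge_1 x a : 1 <= x -> 0 <= a -> 1 <= Rpower x a.
Proof.
  intros Hx Ha; rewrite <- (Rpower_O x) by lra. apply Rle_Rpower; lra.
Qed.

Lemma log2_subpolynomial d n :
  0 < d -> (1 <= n)%nat ->
  INR (Nat.log2 n + 2) <= (2 / d + 2) * Rpower (INR n) d.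
Proof.
  intros Hd Hn.
  assert (Hn1 : 1 <= INR n) by (apply (le_INR 1); auto).
  assert (Hln : INR (Nat.log2 n) * ln 2 <= ln (INR n)).
  { rewrite <- ln_pow by lra.
    assert (Hle : 2 ^ Nat.log2 n <= INR n).
    { rewrite <- (pow_INR 2); apply le_INR, Nat.log2_spec; lia. }
    destruct Hle as [Hlt|E]; [left; apply ln_increasing; [apply pow_lt; lra|exact Hlt]|].
    rewrite E; right; reflexivity. }
  assert (Hl2 : INR (Nat.log2 n) <= 2 * ln (INR n)).
  { pose proof ln_lt_2; pose proof (pos_INR (Nat.log2 n)); nra. }
  assert (Hexp : 1 + d * ln (INR n) <= Rpower (INR n) d) by apply exp_ineq1_le.
  assert (H1 : 1 <= Rpower (INR n) d) by (apply Rpower_ge_1; lra).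
  assert (H2 : ln (INR n) <= / d * Rpower (INR n) d).
  { apply Rmult_le_reg_l with d; [exact Hd|].
    rewrite <- Rmult_assoc, Rinv_r by lra; lra. }
  rewrite plus_INR; simpl (INR 2); unfold Rdiv; nra.
Qed.

Lemma exists_nat_bound r : exists T, (forall t, INR t <= r -> (t <= T)%nat) /\ INR T <= Rabs r + 1.
Proof.
  destruct (archimed (Rabs r)) as [Hu1 Hu2].
  pose proof (Rabs_pos r); pose proof (Rle_abs r).
  assert (0 < up (Rabs r))%Z by (apply lt_IZR; lra).
  exists (Z.to_nat (up (Rabs r))); split.
  - intros t Ht; rewrite INR_IZR_INZ in Ht.
    assert (Z.of_nat t < up (Rabs r))%Z by (apply lt_IZR; lra). lia.
  - rewrite INR_IZR_INZ, Z2Nat.id by lia; lra.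
Qed.

Lemma subcubic_total d C K :
  0 < d <= 1 ->
  exists C', forall n T : nat, (1 <= n)%nat ->
    INR T <= Rabs C * Rpower (INR (3 * n + 1)) (3 - d) + 1 ->
    INR ((Nat.log2 n + 2) * (K * (n * n) + 3 * T)) <= C' * subcubic (d / 2) n.
Proof.
  intros Hd.
  exists ((2 / (d / 2) + 2) * (INR K + 3 * (Rabs C * Rpower 4 (3 - d) + 1))).
  intros n T Hn HT.
  assert (Hn1 : 1 <= INR n) by (apply (le_INR 1); auto).
  pose proof (log2_subpolynomial (d / 2) n ltac:(lra) Hn) as Hlog.
  set (P := Rpower (INR n) (3 - d)) in *.
  assert (HP1 : 1 <= P) by (apply Rpower_ge_1; lra).
  assert (HP2 : INR n * INR n <= P).
  { replace (INR n * INR n) with (Rpower (INR n) 2); [apply Rle_Rpower; lra|].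
    replace 2 with (INR 2) by reflexivity; rewrite Rpower_pow by lra; ring. }
  assert (HN : Rpower (INR (3 * n + 1)) (3 - d) <= Rpower 4 (3 - d) * P).
  { unfold P; rewrite Rpower_mult_distr by lra.
    apply Rle_Rpower_l; [lra|].
    rewrite plus_INR, mult_INR; simpl (INR 3); simpl (INR 1); lra. }
  assert (HTP : INR T <= (Rabs C * Rpower 4 (3 - d) + 1) * P).
  { pose proof (Rabs_pos C).
    assert (Rabs C * Rpower (INR (3 * n + 1)) (3 - d) <= Rabs C * (Rpower 4 (3 - d) * P))
      by (apply Rmult_le_compat_l; auto).
    lra. }
  unfold subcubic.
  replace (3 - d / 2) with (d / 2 + (3 - d)) by lra.
  rewrite Rpower_plus; fold P.
  rewrite mult_INR, (plus_INR (K * (n * n))), !mult_INR; simpl (INR 3).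
  set (R1 := Rpower (INR n) (d / 2)) in *.
  set (A4 := Rabs C * Rpower 4 (3 - d) + 1) in *.
  pose proof (pos_INR K); pose proof (pos_INR T).
  replace ((2 / (d / 2) + 2) * (INR K + 3 * A4) * (R1 * P))
    with (((2 / (d / 2) + 2) * R1) * ((INR K + 3 * A4) * P)) by ring.
  apply Rmult_le_compat; auto using pos_INR; [nra|].
  assert (INR K * (INR n * INR n) <= INR K * P) by (apply Rmult_le_compat_l; auto).
  lra.
Qed.

Lemma TwoFRP_solves_APSP eps :
  0 < eps -> solvable_in_time TwoFRP (subcubic eps) ->
  solvable_in_time APSP (subcubic (Rmin eps 1 / 2)).
Proof.
  intros Heps Hsol c.
  destruct (Hsol (c + 5)%nat) as (p & k & C & Hp); clear Hsol.
  set (e := address_exponent k c); set (m := cmd_regs p).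
  destruct (apsp_cost_bound m c e) as [K HK].
  assert (Hd : 0 < Rmin eps 1 <= 1).
  { split; [apply Rmin_pos; lra|apply Rmin_r]. }
  destruct (subcubic_total (Rmin eps 1) C K Hd) as [C' HC'].
  exists (apsp_program c e m p), (word_factor k c), C'.
  intros G (Hn & Hll & Hcyc & Hw).
  cbn [size APSP encode instance correct] in *.
  set (n := order G) in *.
  set (r := Rabs C * Rpower (INR (3 * n + 1)) (3 - Rmin eps 1)).
  assert (Hr : 0 <= r).
  { apply Rmult_le_pos; [apply Rabs_pos|left; apply exp_pos]. }
  destruct (exists_nat_bound r) as (T & HT & HTr).
  rewrite (Rabs_pos_eq r Hr) in HTr.
  assert (Hb : (0 <= entry_bound c n)%Z).
  { unfold entry_bound; pose proof (pow_one_le (Z.of_nat n) c ltac:(lia)); nia. }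
  destruct (apsp_program_runs (word_factor k c * (Nat.log2 n + 1)) n (entry_bound c n)
    ((entry_bound c n + 1) * Z.of_nat n * Z.of_nat n) (address_space k c n) Hn Hb
    ltac:(nia) ltac:(nia) ltac:(nia) ltac:(nia) (address_space_large k c n Hn)
    (fun z => word_large k c n z Hn)
    (k * (Nat.log2 (3 * n + 1) + 1)) m T p (Nat.le_refl _) (address_space_words k c n))
    with (G := G) (c := c) (e := e) as (t & s & Hex & Ht & D & HD & Hout); auto.
  - intros X HX _.
    destruct (Hp _ (gadget_valid c n _ X Hn eq_refl HX))
      as (t & s & out & Hex & Ht & Hout & a & -> & Ha).
    exists t, s, a; split; [exact Hex|split; [|split; assumption]].
    apply HT; eapply Rle_trans; [exact Ht|].
    cbn [size TwoFRP graph_of gadget order]; unfold subcubic, r.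
    assert (1 <= INR (3 * n + 1)) by (apply (le_INR 1); lia).
    assert (Hpow : Rpower (INR (3 * n + 1)) (3 - eps) <= Rpower (INR (3 * n + 1)) (3 - Rmin eps 1))
      by (apply Rle_Rpower; [auto|pose proof (Rmin_l eps 1); lra]).
    assert (0 < Rpower (INR (3 * n + 1)) (3 - eps)) by apply exp_pos.
    pose proof (Rle_abs C); pose proof (Rabs_pos C); nra.
  - rewrite Nat2Z.inj_pow in Hw; exact Hw.
  - exists t, s, (encode_matrix n D); split; [exact Hex|split; [|split; [exact Hout|]]].
    + eapply Rle_trans; [apply le_INR; eapply Nat.le_trans; [exact Ht|apply HK; exact Hn]|].
      apply HC'; auto.
    + exists D; split; [reflexivity|exact HD].
Qed.

Theorem theorem5 :
  APSP_hardness_conjecture ->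
  forall eps : R, (0 < eps)%R -> ~ solvable_in_time TwoFRP (subcubic eps).
Proof.
  intros H eps Heps Hsol; apply (H (Rmin eps 1 / 2)).
  - pose proof (Rmin_pos eps 1 Heps ltac:(lra)); lra.
  - apply TwoFRP_solves_APSP; assumption.
Qed.
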